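(* Let $\Gamma=(m_{i,j})_{i,j\in I}$ be a Coxeter matrix and $G$ a subgroup of $\mathrm{Aut}(\Gamma)$. Let $\tilde J$ be the set of all spherical orbits of $I$ under $G$ and let $J=\bigcup_{\alpha\in\tilde J}\alpha\subseteq I$. Let $\tilde\Gamma=(|r_\alpha r_\beta|)_{\alpha,\beta\in\tilde J}$ be the type of the (admissible) partition $\tilde J$ of $\Gamma_J$, and set $\tilde{\mathbf S}=\{\mathbf r_\alpha\mid\alpha\in\tilde J\}$; let $\tilde B^+$ be the submonoid of $B^+_\Gamma$ generated by $\tilde{\mathbf S}$ and $\tilde B$ the subgroup of $B_\Gamma$ generated by $\tilde{\mathbf S}$. Then: (1) $(B^+_\Gamma)^G=\tilde B^+$, and hence the pair $((B^+_\Gamma)^G,\tilde{\mathbf S})$ is isomorphic to the positive Artin-Tits system $(B^+_{\tilde\Gamma},\mathbf S_{\tilde\Gamma})$ of type $\tilde\Gamma$; (2) if $\Gamma$ is spherical, then $(B_\Gamma)^G=\tilde B$, and hence the pair $((B_\Gamma)^G,\tilde{\mathbf S})$ is isomorphic to the Artin-Tits system $(B_{\tilde\Gamma},\mathbf S_{\tilde\Gamma})$ of type $\tilde\Gamma$.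
   Context: A Coxeter matrix over an arbitrary (possibly infinite) set $I$ is a family $\Gamma=(m_{i,j})_{i,j\in I}$ with $m_{i,j}=m_{j,i}\in\mathbb N_{\geq 1}\cup\{\infty\}$ and $m_{i,j}=1\iff i=j$. $\mathrm{Aut}(\Gamma)$ is the group of bijections $f:I\to I$ with $m_{f(i),f(j)}=m_{i,j}$ for all $i,j$. For $n\in\mathbb N$, $\prod_n(x,y)$ is the alternating product $xyxy\cdots$ with $n$ factors starting with $x$. $W_\Gamma$ is the Coxeter group generated by $s_i$ ($i\in I$) with relations $s_i^2=1$ and $\prod_{m_{i,j}}(s_i,s_j)=\prod_{m_{i,j}}(s_j,s_i)$ if $m_{i,j}\ne\infty$. $B_\Gamma$ (resp. $B^+_\Gamma$) is the group (resp. monoid) presented by generators $\mathbf S_\Gamma=\{\mathbf s_i\mid i\in I\}$ and relations $\prod_{m_{i,j}}(\mathbf s_i,\mathbf s_j)=\prod_{m_{i,j}}(\mathbf s_j,\mathbf s_i)$ for $m_{i,j}\neq\infty$; $B^+_\Gamma$ is identified with the submonoid of $B_\Gamma$ generated by $\mathbf S_\Gamma$. The pair $(B_\Gamma,\mathbf S_\Gamma)$ (resp. $(B^+_\Gamma,\mathbf S_\Gamma)$) is the Artin-Tits (resp. positive Artin-Tits) system of type $\Gamma$. Two pairs (group or monoid, generating set) are isomorphic if there is an isomorphism carrying one generating set onto the other. A subgroup $G\le\mathrm{Aut}(\Gamma)$ acts on $W_\Gamma$, $B_\Gamma$, $B^+_\Gamma$ by permuting the generators according to its action on $I$; the superscript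 $G$ denotes the set of elements fixed by $G$. For $w\in W_\Gamma$, $\mathbf w\in B^+_\Gamma$ is the element represented by any reduced word of $w$ (well defined by Tits' theorem). For $J\subseteq I$, $\Gamma_J=(m_{i,j})_{i,j\in J}$ and $W_J=\langle s_j\mid j\in J\rangle$. $J$ (or $\Gamma_J$) is spherical if $W_J$ is finite; then $r_J$ is the unique element of maximal length in $W_J$ and $\mathbf r_J\in B^+_\Gamma$ is the corresponding element. $|r_\alpha r_\beta|$ denotes the order of $r_\alpha r_\beta$ in $W_\Gamma$. Admissibility of $\tilde J$ (a known fact, not needed to parse the statement) means: for every $w$ in the subgroup $\langle r_\alpha\mid \alpha\in\tilde J\rangle$ and every $\alpha\in\tilde J$, either $\ell(ws_i)=\ell(w)+1$ for all $i\in\alpha$ or $\ell(ws_i)=\ell(w)-1$ for all $i\in\alpha$, where $\ell$ is word length on $W_\Gamma$. *)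

(* Defs.v *)
From HB Require Import structures.
From mathcomp Require Import all_boot monoid.
From mathcomp Require Import generic_quotient.
From mathcomp Require Import boolp classical_sets functions cardinality.

Set Implicit Arguments.
Unset Strict Implicit.
Unset Printing Implicit Defensive.

Local Open Scope classical_set_scope.
Local Open Scope group_scope.
Local Open Scope quotient_scope.

Inductive cong (X : Type) (R : seq X -> seq X -> Prop) : seq X -> seq X -> Prop :=
| CongRel a b u v of R u v : cong R (a ++ u ++ b) (a ++ v ++ b)
| CongRefl u : cong R u u
| CongSym u v of cong R u v : cong R v u
| CongTrans u v w of cong R u v & cong R v w : cong R u w.

Section PresentedMonoid.
Variables (X : Type) (R : seq X -> seq X -> Prop).

Definition congb (u v : {classic seq X}) : bool := `[< cong R u v >].

Lemma congb_refl : reflexive congb.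
Proof. by move=> u; apply/asboolP; exact: CongRefl. Qed.

Lemma congb_sym : symmetric congb.
Proof.
by move=> u v; apply/idP/idP => /asboolP h; apply/asboolP; exact: CongSym.
Qed.

Lemma congb_trans : transitive congb.
Proof.
move=> v u w /asboolP uv /asboolP vw; apply/asboolP; exact: CongTrans uv vw.
Qed.

Canonical congb_equiv := EquivRel congb congb_refl congb_sym congb_trans.

Lemma cong_cat u u' v v' :
  cong R u u' -> cong R v v' -> cong R (u ++ v) (u' ++ v').
Proof.
move=> uu' vv'; apply: (@CongTrans _ _ _ (u' ++ v)).
  elim: uu' => [a b r r' h|w|w w' _|w1 w2 w3 _ h1 _ h2].
  - by rewrite -!catA; exact: CongRel.
  - exact: CongRefl.
  - exact: CongSym.
  - exact: CongTrans h1 h2.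
elim: vv' => [a b r r' h|w|w w' _|w1 w2 w3 _ h1 _ h2].
- by rewrite !(catA u'); exact: CongRel.
- exact: CongRefl.
- exact: CongSym.
- exact: CongTrans h1 h2.
Qed.

Definition pmonoid : Type := {eq_quot congb_equiv}.

HB.instance Definition _ := Choice.on pmonoid.
HB.instance Definition _ := EqQuotient.on pmonoid.

Definition pclass (u : seq X) : pmonoid := \pi_pmonoid (u : {classic seq X}).

Lemma pclassP u v : pclass u = pclass v <-> cong R u v.
Proof.
split=> [/eqP|h]; first by rewrite /pclass eqmodE => /asboolP.
by apply/eqP; rewrite /pclass eqmodE; apply/asboolP.
Qed.

Definition pword (x : pmonoid) : seq X := repr x.

Lemma pwordK : cancel pword pclass. Proof. exact: reprK. Qed.

Definition pmul (x y : pmonoid) : pmonoid := pclass (pword x ++ pword y).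

Lemma pmulE u v : pmul (pclass u) (pclass v) = pclass (u ++ v).
Proof. by apply/pclassP/cong_cat; apply/pclassP; rewrite pwordK. Qed.

Fact pmulA : associative pmul.
Proof.
by move=> x y z; rewrite -[x]pwordK -[y]pwordK -[z]pwordK !pmulE catA.
Qed.

Fact pmul1 : left_id (pclass [::]) pmul.
Proof. by move=> x; rewrite -[x]pwordK pmulE. Qed.

Fact pmulr1 : right_id (pclass [::]) pmul.
Proof. by move=> x; rewrite -[x]pwordK pmulE cats0. Qed.

HB.instance Definition _ := isMonoid.Build pmonoid pmulA pmul1 pmulr1.

Definition pgen (x : X) : pmonoid := pclass [:: x].

(* The homomorphism sending each generator [x] to [phi x]; this is meaningful
   when [phi] respects the relations, see [pextend_class]. *)
Definition pextend (M : monoidType) (phi : X -> M) (b : pmonoid) : M :=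
  \prod_(x <- pword b) phi x.

Lemma pextend_class (M : monoidType) (phi : X -> M) u :
    (forall v w, R v w -> \prod_(x <- v) phi x = \prod_(x <- w) phi x) ->
  pextend phi (pclass u) = \prod_(x <- u) phi x.
Proof.
move=> phiR; have: cong R (pword (pclass u)) u by apply/pclassP; rewrite pwordK.
rewrite /pextend; move: (pword _) => u'.
elim=> [a b v w /phiR h|//|v w _ -> //|v w w' _ -> _ -> //].
by rewrite !big_cat /= h.
Qed.

Lemma pextendM (M : monoidType) (phi : X -> M) (x y : pmonoid) :
    (forall v w, R v w -> \prod_(x <- v) phi x = \prod_(x <- w) phi x) ->
  pextend phi (x * y) = pextend phi x * pextend phi y.
Proof.
move=> phiR; rewrite -[x]pwordK -[y]pwordK [X in pextend _ X]pmulE.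
by rewrite !pextend_class // big_cat.
Qed.

End PresentedMonoid.

(* The letters of a group word are pairs [(x, b)], standing for [x] when [b] is
   true and for [x^-1] otherwise.  Relations are between positive words. *)
Inductive group_rel (X : Type) (R : seq X -> seq X -> Prop) :
  seq (X * bool) -> seq (X * bool) -> Prop :=
| GroupRel u v of R u v :
    group_rel R [seq (x, true) | x <- u] [seq (x, true) | x <- v]
| GroupCancel x b : group_rel R [:: (x, b); (x, ~~ b)] [::].

Section PresentedGroup.
Variables (X : Type) (R : seq X -> seq X -> Prop).

Definition pgroup : Type := pmonoid (group_rel R).

HB.instance Definition _ := Monoid.on pgroup.

Definition winv (u : seq (X * bool)) : seq (X * bool) :=
  rev [seq (x.1, ~~ x.2) | x <- u].

Lemma winvK : involutive winv.
Proof.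
move=> u; rewrite /winv map_rev revK -map_comp -[RHS]map_id.
by apply: eq_map => -[x b] /=; rewrite negbK.
Qed.

Lemma cong_winvl u : cong (group_rel R) (winv u ++ u) [::].
Proof.
elim: u => [|[x b] u IHu]; first exact: CongRefl.
rewrite /winv /= rev_cons cat_rcons -/(winv u).
apply: CongTrans IHu.
have /= := @CongRel _ _ (winv u) u _ _ (GroupCancel R x (~~ b)).
by rewrite negbK.
Qed.

Lemma cong_winvr u : cong (group_rel R) (u ++ winv u) [::].
Proof. by rewrite -{1}[u]winvK; exact: cong_winvl. Qed.

Definition pinv (g : pgroup) : pgroup := pclass (group_rel R) (winv (pword g)).

Fact pmulVg : left_inverse (1 : pgroup) pinv *%g.
Proof.
move=> g; rewrite -{2}[g]pwordK [LHS]pmulE.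
by apply/pclassP; exact: cong_winvl.
Qed.

Fact pmulgV : right_inverse (1 : pgroup) pinv *%g.
Proof.
move=> g; rewrite -{1}[g]pwordK [LHS]pmulE.
by apply/pclassP; exact: cong_winvr.
Qed.

HB.instance Definition _ := hasInv.Build pgroup pinv.
HB.instance Definition _ := Monoid_isGroup.Build pgroup pmulVg pmulgV.

Definition ggen (x : X) : pgroup := pgen (group_rel R) (x, true).

(* As [pextend], for groups. *)
Definition gextend (H : groupType) (phi : X -> H) : pgroup -> H :=
  pextend (fun x => if x.2 then phi x.1 else (phi x.1)^-1).

Lemma gextend_rel (H : groupType) (phi : X -> H) :
    (forall v w, R v w -> \prod_(x <- v) phi x = \prod_(x <- w) phi x) ->
  forall v w, group_rel R v w ->
  \prod_(x <- v) (if x.2 then phi x.1 else (phi x.1)^-1) =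
  \prod_(x <- w) (if x.2 then phi x.1 else (phi x.1)^-1).
Proof.
move=> phiR _ _ [v w /phiR|x b]; first by rewrite !big_map.
by rewrite !big_cons big_nil mulg1; case: b; rewrite /= ?mulgV ?mulVg.
Qed.

Lemma gextendM (H : groupType) (phi : X -> H) (x y : pgroup) :
    (forall v w, R v w -> \prod_(x <- v) phi x = \prod_(x <- w) phi x) ->
  gextend phi (x * y) = gextend phi x * gextend phi y.
Proof. by move=> phiR; apply: pextendM; exact: gextend_rel. Qed.

End PresentedGroup.

Definition submonoid (M : monoidType) : set (set M) :=
  [set A | A 1 /\ forall x y, A x -> A y -> A (x * y)].

Definition subgroup (H : groupType) : set (set H) :=
  [set A | submonoid A /\ forall x, A x -> A x^-1].

Definition gen_monoid (M : monoidType) (S : set M) : set M :=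
  smallest (@submonoid M) S.

Definition gen_group (H : groupType) (S : set H) : set H :=
  smallest (@subgroup H) S.

(* The order of an element, [None] standing for infinity. *)
Definition gorder (H : groupType) (x : H) : option nat :=
  match pselect (exists n, (0 < n)%N && (x ^+ n == 1)) with
  | left ex => Some (ex_minn ex)
  | right _ => None
  end.

(* [A] and [B] carry the induced monoid structures.  When they are subgroups
   this is the same as an isomorphism of groups. *)
Definition pair_iso (M N : monoidType) (A S : set M) (B T : set N) : Prop :=
  exists f : M -> N,
    [/\ set_bij A B f, f 1 = 1,
        forall x y, A x -> A y -> f (x * y) = f x * f y
      & f @` S = T].

(* [None] stands for infinity. *)
Definition cmatrix (I : Type) := I -> I -> option nat.

Definition coxeter_matrix (I : Type) (m : cmatrix I) : Prop :=
  [/\ forall i j, m i j = m j i,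
      forall i j, m i j <> Some 0%N
    & forall i j, m i j = Some 1%N <-> i = j].

Definition Aut (I : Type) (m : cmatrix I) : set (I -> I) :=
  [set f | bijective f /\ forall i j, m (f i) (f j) = m i j].

Definition subgroup_Aut (I : Type) (m : cmatrix I) (G : set (I -> I)) : Prop :=
  [/\ G `<=` Aut m, G id, forall f g, G f -> G g -> G (f \o g)
    & forall f, G f -> exists g, [/\ G g, cancel f g & cancel g f]].

Fixpoint alt (X : Type) (n : nat) (x y : X) : seq X :=
  if n is n'.+1 then x :: alt n' y x else [::].

Section Coxeter.
Variables (I : Type) (m : cmatrix I).

Inductive braid_rel : seq I -> seq I -> Prop :=
| BraidRel i j n of m i j = Some n : braid_rel (alt n i j) (alt n j i).

Inductive coxeter_rel : seq I -> seq I -> Prop :=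
| CoxeterBraid u v of braid_rel u v : coxeter_rel u v
| CoxeterSquare i : coxeter_rel [:: i; i] [::].

Definition coxeter_group := pgroup coxeter_rel.
Definition artin_group := pgroup braid_rel.
Definition artin_monoid := pmonoid braid_rel.

Definition s_ (i : I) : coxeter_group := ggen coxeter_rel i.
Definition artin_gen (i : I) : artin_group := ggen braid_rel i.
Definition artin_mgen (i : I) : artin_monoid := pgen braid_rel i.

(* The canonical homomorphism from the monoid to the group, along which the
   monoid is identified with a submonoid of the group. *)
Definition artin_incl : artin_monoid -> artin_group := pextend artin_gen.

Definition artin_gact (f : I -> I) : artin_group -> artin_group :=
  gextend (fun i => artin_gen (f i)).

Definition artin_mact (f : I -> I) : artin_monoid -> artin_monoid :=
  pextend (fun i => artin_mgen (f i)).

Definition artin_gfixed (G : set (I -> I)) : set artin_group :=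
  [set b | forall f, G f -> artin_gact f b = b].

Definition artin_mfixed (G : set (I -> I)) : set artin_monoid :=
  [set b | forall f, G f -> artin_mact f b = b].

Definition reduced_words (w : coxeter_group) : set (seq I) :=
  [set u | \prod_(i <- u) s_ i = w /\
    forall v, \prod_(i <- v) s_ i = w -> (size u <= size v)%N].

Definition reduced_word (w : coxeter_group) : seq I :=
  xget ([::] : {classic seq I}) (reduced_words w).

Definition length (w : coxeter_group) : nat := size (reduced_word w).

(* By Tits' theorem, any other reduced word of [w] gives the same element. *)
Definition artin_lift (w : coxeter_group) : artin_monoid :=
  \prod_(i <- reduced_word w) artin_mgen i.

Definition parabolic (J : set I) : set coxeter_group := gen_group (s_ @` J).

Definition spherical (J : set I) : Prop := finite_set (parabolic J).

(* A singleton for [J] spherical. *)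
Definition longest_elements (J : set I) : set coxeter_group :=
  [set w | parabolic J w /\ forall v, parabolic J v -> (length v <= length w)%N].

Definition longest (J : set I) : coxeter_group := xget 1 (longest_elements J).

Definition artin_longest (J : set I) : artin_monoid := artin_lift (longest J).

Definition spherical_orbits (G : set (I -> I)) : set (set I) :=
  [set alpha | spherical alpha /\ exists i, alpha = [set f i | f in G]].

Definition folded_matrix (G : set (I -> I)) : cmatrix (spherical_orbits G) :=
  fun alpha beta => gorder (longest (val alpha) * longest (val beta)).

Definition folded_gens (G : set (I -> I)) : set artin_monoid :=
  artin_longest @` spherical_orbits G.

(* The choices above are made in nonempty sets, and the maps extended from the
    generators are homomorphisms. *)

Lemma s_sq i : s_ i * s_ i = 1.
Proof.
rewrite [LHS]pmulE; apply/pclassP.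
have /= := @CongRel _ _ [::] [::] _ _ (GroupRel (CoxeterSquare i)).
exact.
Qed.

Lemma prod_s_surj (w : coxeter_group) : exists u, \prod_(i <- u) s_ i = w.
Proof.
rewrite -[w]pwordK; elim: (pword w) => [|[i b] u [v vu]].
  by exists [::]; rewrite big_nil.
exists (i :: v); rewrite big_cons vu.
have -> : s_ i = pclass (group_rel coxeter_rel) [:: (i, b)].
  case: b => //; apply: (@mulgI _ (s_ i)); rewrite s_sq.
  apply/esym; rewrite [LHS]pmulE; apply/pclassP.
  exact: (@CongRel _ _ [::] [::] _ _ (GroupCancel coxeter_rel i true)).
by rewrite [LHS]pmulE.
Qed.

Lemma reduced_wordP w : reduced_words w (reduced_word w).
Proof.
apply: (@xgetPex {classic seq I}).
have ex : exists n, `[< exists2 u, \prod_(i <- u) s_ i = w & size u = n >].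
  by have [u uw] := prod_s_surj w; exists (size u); apply/asboolP; exists u.
case: (ex_minnP ex) => n /asboolP [u uw <-] minu; exists u; split=> // v vw.
by apply: minu; apply/asboolP; exists v.
Qed.

Lemma longestP J : spherical J -> longest_elements J (longest J).
Proof.
move=> /finite_seqP [s Js]; apply: xgetPex.
have J1 : parabolic J 1 by move=> A [[[]]].
have s1 : 1 \in s by have : [set` s] 1 by rewrite -Js.
have bounded k : `[< exists2 w, parabolic J w & length w = k >] ->
    (k <= \max_(w <- s) length w)%N.
  move=> /asboolP [w Jw <-]; apply: leq_bigmax_seq => //.
  by move: Jw; rewrite Js.
have ex : exists k, `[< exists2 w, parabolic J w & length w = k >].
  by exists (length 1); apply/asboolP; exists 1.
case: (ex_maxnP ex bounded) => k /asboolP [w Jw <-] maxw.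
by exists w; split=> // v Jv; apply: maxw; apply/asboolP; exists v.
Qed.

Lemma prod_pgen (X : Type) (R : seq X -> seq X -> Prop) u :
  \prod_(x <- u) pgen R x = pclass R u.
Proof.
by elim: u => [|x u IHu]; rewrite ?big_nil // big_cons IHu [LHS]pmulE.
Qed.

Lemma prod_ggen (X : Type) (R : seq X -> seq X -> Prop) u :
  \prod_(x <- u) ggen R x = pclass (group_rel R) [seq (x, true) | x <- u].
Proof.
by elim: u => [|x u IHu]; rewrite ?big_nil // big_cons IHu [LHS]pmulE.
Qed.

Lemma map_alt (f : I -> I) n i j : map f (alt n i j) = alt n (f i) (f j).
Proof. by elim: n i j => //= n IHn i j; rewrite IHn. Qed.

Lemma artin_inclM : {morph artin_incl : x y / x * y}.
Proof.
move=> x y; apply: pextendM => v w vw.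
rewrite !prod_ggen; apply/pclassP.
by have := @CongRel _ _ [::] [::] _ _ (GroupRel vw); rewrite /= !cats0.
Qed.

Lemma artin_mactM f : Aut m f -> {morph artin_mact f : x y / x * y}.
Proof.
move=> [_ mf] x y; apply: pextendM => _ _ [i j n mij].
rewrite -!(big_map f xpredT (@artin_mgen)) !prod_pgen !map_alt; apply/pclassP.
have mfij : m (f i) (f j) = Some n by rewrite mf.
by have := @CongRel _ _ [::] [::] _ _ (BraidRel mfij); rewrite /= !cats0.
Qed.

Lemma artin_gactM f : Aut m f -> {morph artin_gact f : x y / x * y}.
Proof.
move=> [_ mf] x y; apply: gextendM => _ _ [i j n mij].
rewrite -!(big_map f xpredT (@artin_gen)) !prod_ggen !map_alt; apply/pclassP.
have mfij : m (f i) (f j) = Some n by rewrite mf.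
have := @CongRel _ _ [::] [::] _ _ (GroupRel (BraidRel mfij)).
by rewrite /= !cats0.
Qed.

End Coxeter.

Arguments artin_incl {I} m.
Arguments artin_mfixed {I} m G.
Arguments artin_gfixed {I} m G.
Arguments parabolic {I} m J.
Arguments spherical {I} m J.
Arguments longest {I} m J.
Arguments artin_longest {I} m J.
Arguments spherical_orbits {I} m G.
Arguments folded_matrix {I} m G.
Arguments folded_gens {I} m G.

(* Main.v *)
(* Write [bold w] for the lift to the positive monoid of an element [w] of the
   Coxeter group.  Everything rests on two facts about the positive monoid: it
   is left cancellative, and if all generators in [K] divide [b] on the left
   then [K] is spherical and the longest element of [K], lifted, divides [b].
   Both follow from a description of the equalities [s_i x = s_j y]: there are
   [h] in [W] with left descents [i] and [j] and some [b] such that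
   [x = bold (s_i h) b] and [y = bold (s_j h) b].  This is proved by induction
   on the length and then on the chain of braid moves; two consecutive
   descriptions are merged by taking joins of left divisors lifted from [W],
   which exist by Newman's lemma.

   A nontrivial fixed element is divisible by a whole orbit of generators, hence
   by the lift of its longest element, and induction on the length shows that
   the fixed submonoid is generated by these lifts.  For two orbits, the longest
   element of their union is the alternating product of the two longest elements
   with [|r_alpha r_beta|] factors, so the homomorphism from the positive monoid
   of the folded type is well defined and respects least common multiples of
   generators; with cancellation in the target this makes it injective.

   For spherical type the square of the Garside element is central, fixed and a
   multiple of every generator, for both types, so both groups are groups of
   fractions with powers of it as denominators.

   That [s_i s_j] has order exactly [m i j] comes from the contragredient of the
   geometric representation; the exchange condition comes from the parity of the
   number of occurrences of a reflection in a word. *)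
Require Import Defs.
From Stdlib Require Import Reals Lra.
From mathcomp Require Import all_boot monoid.
From mathcomp Require Import boolp classical_sets functions cardinality.

Set Implicit Arguments.
Unset Strict Implicit.
Unset Printing Implicit Defensive.

Local Open Scope classical_set_scope.
Local Open Scope group_scope.

(** * The contragredient of the geometric representation *)

Section Contragredient.
Variables (I : Type) (m : cmatrix I).
Hypothesis m_coxeter : coxeter_matrix m.
Local Open Scope R_scope.

(** This is [-2 B(e_i, e_j)] for the Tits form [B(e_i, e_j) = - cos (PI / m i j)]; an infinite label
    gets the limit value. *)
Definition cox_coef (i j : I) : R :=
  if m i j is Some n then 2 * cos (PI / INR n) else 2.

Local Notation a := cox_coef.

(** Here [f] is a linear form given by its values on the basis [e_k], composed with the reflection
    [e_k |-> e_k + a i k * e_i]. Working in the dual avoids finitely supported vectors. *)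
Definition cox_refl (i : I) (f : I -> R) : I -> R := fun k => f k + a i k * f i.

Lemma cox_coef_sym i j : a i j = a j i.
Proof. by case: m_coxeter => msym _ _; rewrite /a msym. Qed.

Lemma cox_coef_diag i : a i i = -2.
Proof.
case: m_coxeter => _ _ /(_ i i) [_ /(_ erefl) mii].
by rewrite /a mii /= Rdiv_1_r cos_PI; lra.
Qed.

Lemma cox_reflK i : involutive (cox_refl i).
Proof.
by move=> f; apply/funext => k; rewrite /cox_refl cox_coef_diag; lra.
Qed.

Section Pair.
Variables (i j : I).

Definition cox_rot (f : I -> R) := cox_refl i (cox_refl j f).

Lemma cox_rot_i f : cox_rot f i = - f i - a i j * f j.
Proof.
rewrite /cox_rot /cox_refl !cox_coef_diag (cox_coef_sym j i); lra.
Qed.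

Lemma cox_rot_j f : cox_rot f j = a i j * f i + (a i j * a i j - 1) * f j.
Proof.
rewrite /cox_rot /cox_refl !cox_coef_diag (cox_coef_sym j i); lra.
Qed.

Lemma cox_rot_k f k : cox_rot f k = f k + a j k * f j + a i k * (f i + a i j * f j).
Proof. by rewrite /cox_rot /cox_refl (cox_coef_sym j i). Qed.

Section Finite.
Variable n : nat.
Hypotheses (mij : m i j = Some n) (n_gt1 : (1 < n)%N).

Let th := PI / INR n.

Let INRn : 2 <= INR n.
Proof. by rewrite -[2]/(INR 2); apply: le_INR; exact/leP. Qed.

Let sin_th : 0 < sin th.
Proof.
have PI0 := PI_RGT_0.
apply: sin_gt_0; first by apply: Rdiv_lt_0_compat; lra.
apply: (Rmult_lt_reg_r (INR n)); first lra.
rewrite /th /Rdiv Rmult_assoc Rinv_l; nra.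
Qed.

Let aij : a i j = 2 * cos th. Proof. by rewrite /a mij. Qed.

(* In these coordinates [cox_rot] is the rotation of angle [2 * th]. *)
Lemma cox_rot_iter l f :
  let g := iter l cox_rot f in
  g i + cos th * g j =
    cos (INR l * (2 * th)) * (f i + cos th * f j) - sin (INR l * (2 * th)) * (sin th * f j) /\
  sin th * g j =
    sin (INR l * (2 * th)) * (f i + cos th * f j) + cos (INR l * (2 * th)) * (sin th * f j).
Proof.
elim: l => [|l]; first by rewrite /= !Rmult_0_l sin_0 cos_0; lra.
rewrite S_INR iterS; move: (iter l _ _) => g [IH1 IH2].
rewrite /= cox_rot_i cox_rot_j aij Rmult_plus_distr_r Rmult_1_l cos_plus sin_plus.
have sc := sin2_cos2 th; rewrite /Rsqr in sc.
rewrite cos_2a sin_2a.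
move: IH1 IH2; move: (cos (INR l * _)) (sin (INR l * _)) => C S IH1 IH2.
set u := f i + _ in IH1 IH2 *; set v := sin th * f j in IH1 IH2 *.
set s := sin th in sc IH1 IH2 *; set c := cos th in sc IH1 IH2 *.
have ss : s * s = 1 - c * c by lra.
have Cu : C * u = g i + c * g j + S * v by lra.
have Cv : C * v = s * g j - S * u by lra.
split.
  have -> : (C * (c * c - s * s) - S * (2 * s * c)) * u -
    (S * (c * c - s * s) + C * (2 * s * c)) * v =
    (c * c - s * s) * (C * u - S * v) - 2 * s * c * (S * u + C * v) by ring.
  rewrite -IH1 -IH2.
  have -> : 2 * s * c * (s * g j) = 2 * c * (s * s) * g j by ring.
  by rewrite ss; ring.
have -> : (S * (c * c - s * s) + C * (2 * s * c)) * u +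
  (C * (c * c - s * s) - S * (2 * s * c)) * v =
  (c * c - s * s) * (S * u + C * v) + 2 * s * c * (C * u - S * v) by ring.
by rewrite -IH1 -IH2 ss; ring.
Qed.

Lemma cox_rot_iter_n f : iter n cox_rot f = f.
Proof.
have nth : INR n * (2 * th) = 2 * PI.
  by rewrite /th; field; lra.
have [] := cox_rot_iter n f; rewrite nth cos_2PI sin_2PI => E1 E2.
have Ej : iter n cox_rot f j = f j.
  by apply: (Rmult_eq_reg_l (sin th)); lra.
have Ei : iter n cox_rot f i = f i by rewrite Ej in E1; lra.
apply/funext => k.
(* This is the Gram determinant of [2 B] on the plane of [i] and [j], equal to [(2 * sin th)^2]. *)
have D : 4 - a i j * a i j <> 0.
  have sc := sin2_cos2 th; rewrite /Rsqr in sc.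
  by rewrite aij; nra.
(* Projecting away the plane of [i] and [j] gives an invariant of [cox_rot]. *)
pose inv g := g k + (2 * a i k + a i j * a j k) / (4 - a i j * a i j) * g i
  + (2 * a j k + a i j * a i k) / (4 - a i j * a i j) * g j.
have invE : forall g, inv (cox_rot g) = inv g.
  by move=> g; rewrite /inv cox_rot_k cox_rot_i cox_rot_j; field.
have : inv (iter n cox_rot f) = inv f.
  by elim: (n) => //= l <-; exact: invE.
by rewrite /inv Ei Ej; lra.
Qed.

(** The indicator of [i] has rotated coordinates [(1, 0)], so returning to it forces
    [cos (2 * l * th) = 1], hence [sin (l * th) = 0] and [l * th] is a multiple of [PI]. *)
Lemma cox_rot_fix l : (forall f, iter l cox_rot f = f) -> (n %| l)%N.
Proof.
move=> /(_ (fun k => if `[< k = i >] then 1 else 0)) fix_l.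
have ij : i <> j.
  move=> ij; case: m_coxeter => _ _ /(_ i j) [_ /(_ ij)].
  by rewrite mij => -[n1]; move: (n_gt1); rewrite n1.
have [+ _] := cox_rot_iter l (fun k => if `[< k = i >] then 1 else 0).
rewrite fix_l; case: asboolP => // _; case: asboolP => [/esym//|_] E.
have sin0 : sin (INR l * th) = 0.
  have := cos_2a_sin (INR l * th).
  rewrite (_ : 2 * _ = INR l * (2 * th)); last ring.
  by move=> E2; nra.
have [k] := sin_eq_0_0 _ sin0; rewrite /th => Ek.
have {}Ek : INR l = IZR k * INR n.
  apply: (Rmult_eq_reg_r (PI / INR n)).
    by rewrite Ek; field; lra.
  by apply: Rgt_not_eq; apply: Rdiv_lt_0_compat; [exact: PI_RGT_0|lra].
have k0 : (0 <= k)%Z.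
  apply: le_IZR; have := pos_INR l; nra.
apply/dvdnP; exists (Z.to_nat k).
apply: INR_eq; rewrite -multE mult_INR Ek; congr (_ * _).
by rewrite INR_IZR_INZ Znat.Z2Nat.id.
Qed.

End Finite.

(** With coefficient [2] the sum [f i + f j] is invariant and [f i] drops by twice that sum at each
    turn, so the indicator of [i] never returns. *)
Lemma cox_rot_free l : m i j = None -> (forall f, iter l cox_rot f = f) -> l = 0%N.
Proof.
move=> mij /(_ (fun k => if `[< k = i >] then 1 else 0)).
set f := fun k => _; have aij : a i j = 2 by rewrite /a mij.
have ij : i <> j.
  by move=> ij; case: m_coxeter => _ _ /(_ i j) [_ /(_ ij)]; rewrite mij.
have : (iter l cox_rot f i + iter l cox_rot f j = 1)
    /\ iter l cox_rot f i = 1 - 2 * INR l.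
  elim: l => [|l]; rewrite /= ?cox_rot_i ?cox_rot_j ?aij.
    by rewrite /f; case: asboolP => // _; case: asboolP => [/esym//|_]; lra.
  by rewrite -/(INR l.+1) S_INR => -[]; lra.
move=> [_ +] E; rewrite E /f; case: asboolP => // _ l0.
by apply: INR_eq; rewrite /=; lra.
Qed.

End Pair.

End Contragredient.

(** * Alternating products in a group *)

Section Alternating.
Variable G : groupType.
Implicit Types a b : G.

(** Peeling off one letter reduces this to [a * (b * a) ^+ n = (a * b) ^+ n.+1 * b]. *)
Lemma prod_alt_expg n a b : a * a = 1 -> b * b = 1 ->
  \prod_(x <- alt n a b) x = (a * b) ^+ n * \prod_(x <- alt n b a) x.
Proof.
elim: n a b => [|n IHn] a b aa bb; first by rewrite mul1g.
rewrite /= !big_cons (IHn b a) // !mulgA; congr (_ * _).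
elim: n {IHn} => [|n IHn]; first by rewrite expg0 expg1 mulg1 -mulgA bb mulg1.
by rewrite expgS !mulgA -(mulgA (a * b)) IHn [in RHS]expgS !mulgA.
Qed.

Lemma prod_altC n a b : a * a = 1 -> b * b = 1 ->
  \prod_(x <- alt n a b) x = \prod_(x <- alt n b a) x <-> (a * b) ^+ n = 1.
Proof.
move=> aa bb; rewrite (prod_alt_expg n aa bb); split=> [|->]; last by rewrite mul1g.
by rewrite -[RHS]mul1g => /mulIg.
Qed.

Lemma involution_inv a : a * a = 1 -> a^-1 = a.
Proof. exact: mulg1_eq. Qed.

Lemma prod_alt_double n a b :
  \prod_(x <- alt n.*2 a b) x = (a * b) ^+ n.
Proof. by elim: n => [|n IHn]; rewrite ?big_nil // doubleS /= !big_cons IHn expgS mulgA. Qed.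

End Alternating.

(** * Words in the Coxeter group and the parity of reflections *)

Section CoxeterWords.
Variables (I : Type) (m : cmatrix I).
Hypothesis m_coxeter : coxeter_matrix m.

Let m_coxeter_sym i j : m i j = m j i. Proof. by case: m_coxeter. Qed.

Local Notation W := (coxeter_group m).
Local Notation s := (s_ m).
Local Notation pi u := (\prod_(i <- u) s i).

Lemma pi_cat u v : pi (u ++ v) = pi u * pi v.
Proof. exact: big_cat. Qed.

(** Forgetting exponents turns the cancellation of a letter with its inverse into the relation
    [s_i^2 = 1], so the group is also the monoid presented by the Coxeter relations. *)
Lemma pi_eqP u v : pi u = pi v <-> cong (coxeter_rel m) u v.
Proof.
split=> [|uv].
  rewrite !prod_ggen => /pclassP.
  have mapK w : [seq x.1 | x <- [seq (x, true) | x <- w]] = w :> seq I.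
    by elim: w => //= x w ->.
  rewrite -{2}[u]mapK -{2}[v]mapK.
  elim=> [a b _ _ [v1 v2 v12|i e]|w|w w' _ IH|w1 w2 w3 _ IH1 _ IH2].
  - by rewrite !map_cat !mapK; exact: CongRel.
  - rewrite !map_cat /=.
    by apply: (@CongRel _ _ _ _ [:: i; i] [::]); exact: CoxeterSquare.
  - exact: CongRefl.
  - exact: CongSym.
  - exact: CongTrans IH1 IH2.
rewrite !prod_ggen; apply/pclassP.
elim: uv => [a b r r' h|w|w w' _|w1 w2 w3 _ h1 _ h2].
- by rewrite !map_cat; apply: CongRel; exact: GroupRel.
- exact: CongRefl.
- exact: CongSym.
- exact: CongTrans h1 h2.
Qed.

Lemma pi_braid i j n : m i j = Some n -> pi (alt n i j) = pi (alt n j i).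
Proof.
move=> mij; apply/pi_eqP.
have /(@CongRel _ _ [::] [::]) := CoxeterBraid (BraidRel mij).
by rewrite /= !cats0.
Qed.

Lemma sK i : s i * s i = 1. Proof. exact: s_sq. Qed.

Lemma sKg i : cancel (mul (s i)) (mul (s i)).
Proof. by move=> w; rewrite mulgA sK mul1g. Qed.

Lemma sgK i : cancel (mul^~ (s i)) (mul^~ (s i)).
Proof. by move=> w; rewrite -mulgA sK mulg1. Qed.

Lemma sV i : (s i)^-1 = s i. Proof. exact/involution_inv/sK. Qed.

Lemma pi_rev u : pi (rev u) = (pi u)^-1.
Proof.
elim: u => [|i u IHu]; first by rewrite !big_nil invg1.
by rewrite rev_cons -cats1 pi_cat IHu big_cons big_nil mulg1 big_cons invgM sV.
Qed.

Lemma pi_alt n i j : pi (alt n i j) = \prod_(x <- alt n (s i) (s j)) x.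
Proof. by elim: n i j => [|n IHn] i j; rewrite ?big_nil //= !big_cons IHn. Qed.

Lemma s_expg i j n : m i j = Some n -> (s i * s j) ^+ n = 1.
Proof. by move/pi_braid; rewrite !pi_alt prod_altC ?sK. Qed.

(* The parity of the number of occurrences of [t] among the reflections
   [s_1 .. s_(k-1) s_k s_(k-1) .. s_1] attached to the word [u]; it turns out
   to depend on [pi u] only. *)
Fixpoint refl_parity (u : seq I) (t : W) : bool :=
  if u is i :: u' then (t == s i) (+) refl_parity u' (s i * t * s i) else false.

Lemma refl_parity_cat u v t :
  refl_parity (u ++ v) t = refl_parity u t (+) refl_parity v ((pi u)^-1 * t * pi u).
Proof.
elim: u t => [|i u IHu] t /=; first by rewrite big_nil invg1 mul1g mulg1.
by rewrite IHu addbA big_cons invgM sV !mulgA.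
Qed.

Lemma refl_parity_alt n i j t :
  refl_parity (alt n i j) t = odd (\sum_(k < n) (t == (s i * s j) ^+ k * s i)%g).
Proof.
elim: n i j t => [|n IHn] i j t /=; first by rewrite big_ord0.
rewrite big_ord_recl oddD oddb expg0 mul1g IHn; congr (_ (+) odd _).
apply: eq_bigr => k _ /=; congr (nat_of_bool _).
have eq_conj (x y : W) : (s i * x * s i == y) = (x == s i * y * s i).
  by apply/eqP/eqP => [<-|->]; rewrite !mulgA sK mul1g -mulgA sK mulg1.
rewrite eq_conj; congr (_ == _ * _).
rewrite /bump /= add1n.
elim: (nat_of_ord k) => [|l IHl]; first by rewrite !gsimp.
by rewrite [in RHS]expgS -IHl [in LHS]expgS !mulgA.
Qed.

(** Since [(s_i s_j)^n = 1], the two words list the same reflections in opposite orders: index [k]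
    matches [n - 1 - k]. *)
Lemma refl_parity_braid i j n : m i j = Some n ->
  refl_parity (alt n i j) = refl_parity (alt n j i).
Proof.
move=> mij; apply/funext => t; rewrite !refl_parity_alt; congr (odd _).
rewrite [RHS](reindex_inj rev_ord_inj) /=; apply: eq_bigr => k _.
congr (nat_of_bool (_ == _)).
have inv : s i * s j = (s j * s i)^-1 by rewrite invgM !sV.
apply: (@mulgI _ ((s j * s i) ^+ k.+1)).
have := s_expg (etrans (m_coxeter_sym j i) mij); rewrite inv expVgn.
set x := s j * s i => xn.
rewrite [in RHS]mulgA -expgnDr subnKC // xn mul1g expgS -mulgA mulVKg.
by rewrite /x sgK.
Qed.

Lemma refl_parity_pi u v : pi u = pi v -> refl_parity u = refl_parity v.
Proof.
move=> /pi_eqP; elim=> [a b w w' ww'|//|//|_ _ _ _ -> _ -> //].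
have [Nww' pww'] : refl_parity w = refl_parity w' /\ pi w = pi w'.
  case: ww' => [_ _ [i j n mij]|i].
    by split; [exact: refl_parity_braid | exact: pi_braid].
  split; last by rewrite !big_cons !big_nil mulg1 sK.
  apply/funext => t /=.
  have -> : (s i * t * s i == s i) = (t == s i).
    apply/eqP/eqP => [E|->]; last by rewrite sK mul1g.
    by rewrite -[t](sKg i) -[s i * t](sgK i) E sK mulg1.
  by rewrite addbF addbb.
by apply/funext => t; rewrite !refl_parity_cat Nww' pww'.
Qed.

(** An odd count is nonzero, so [t] is the reflection attached to some letter, and multiplying by it
    deletes that letter. *)
Lemma refl_parity_exchange u t : refl_parity u t ->
  exists u1 i u2, u = u1 ++ i :: u2 /\ t * pi u = pi (u1 ++ u2).
Proof.
elim: u t => //= i u IHu t.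
case: eqP => [-> _|_ /= /IHu [u1 [j [u2 [-> E]]]]].
  by exists [::], i, u; rewrite big_cons mulgA sK mul1g.
exists (i :: u1), j, u2; split=> //.
by rewrite cat_cons [in RHS]big_cons -E [in LHS]big_cons !mulgA sK mul1g.
Qed.

(** * Length and the exchange condition *)

Local Notation len := (@length I m).
Local Notation rw := (@reduced_word I m).

Lemma rwK w : pi (rw w) = w. Proof. by case: (reduced_wordP w). Qed.

Lemma len_le u : (len (pi u) <= size u)%N.
Proof. by case: (reduced_wordP (pi u)) => _; apply. Qed.

Definition reduced u := len (pi u) = size u.

Lemma reduced_rw w : reduced (rw w). Proof. by rewrite /reduced rwK. Qed.

Lemma len1 : len 1 = 0%N.
Proof. by apply/eqP; rewrite -leqn0; have := len_le [::]; rewrite big_nil. Qed.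

Lemma len_eq0 w : len w = 0%N -> w = 1.
Proof. by rewrite -{2}[w]rwK /length => /size0nil ->; rewrite big_nil. Qed.

Lemma lenM v w : (len (v * w)%g <= len v + len w)%N.
Proof. by rewrite -{1}[v]rwK -{1}[w]rwK -pi_cat -size_cat; exact: len_le. Qed.

Lemma lenV w : len w^-1 = len w.
Proof.
suff le v : (len v^-1%g <= len v)%N by apply/eqP; rewrite eqn_leq le -{1}[w]invgK le.
by rewrite -{1}[v]rwK -pi_rev -[len v]size_rev; exact: len_le.
Qed.

Definition ldesc i w := (len (s i * w)%g < len w)%N.
Definition rdesc i w := (len (w * s i)%g < len w)%N.

Lemma ldescV i w : ldesc i w^-1 = rdesc i w.
Proof. by rewrite /ldesc /rdesc -[s i * _]invgK invgM invgK sV !lenV. Qed.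

(** Odd parity, read on a reduced word, lets exchange shorten it. Even parity becomes odd for
    [i :: u], so there [s i] shortens [s i * pi u]. *)
Lemma ldesc_parity i u : ldesc i (pi u) = refl_parity u (s i).
Proof.
have sub w v : pi v = w -> refl_parity v (s i) -> (len (s i * w)%g < len w)%N.
  move=> <- {w}; rewrite -[pi v]rwK (@refl_parity_pi v (rw (pi v))); last by rewrite rwK.
  set r := rw _ => /refl_parity_exchange [u1 [j [u2 [E ->]]]].
  rewrite -/(length _) [X in (_ < X)%N](_ : _ = size r); last exact: reduced_rw.
  by rewrite E size_cat /= addnS -size_cat ltnS len_le.
case E: (refl_parity u (s i)); first exact: sub E.
apply/negbTE; rewrite -leqNgt ltnW //.
rewrite -{1}[pi u](sKg i) (@sub _ (i :: u)) ?big_cons //=.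
by rewrite eqxx sK mul1g E.
Qed.

Lemma exchange i u : ldesc i (pi u) ->
  exists u1 j u2, u = u1 ++ j :: u2 /\ s i * pi u = pi (u1 ++ u2).
Proof. by rewrite ldesc_parity; exact: refl_parity_exchange. Qed.

Lemma ldescN i w : ~~ ldesc i w -> len (s i * w) = (len w).+1.
Proof.
rewrite -[w]rwK; set u := rw w => nd.
have : ldesc i (s i * pi u).
  have -> : s i * pi u = pi (i :: u) by rewrite big_cons.
  rewrite ldesc_parity /= eqxx sK mul1g addTb.
  by rewrite -ldesc_parity.
rewrite /ldesc sKg => lt; apply/eqP; rewrite eqn_leq lt andbT.
apply: leq_trans (lenM _ _) _; rewrite -add1n leq_add2r.
by have := len_le [:: i]; rewrite big_cons big_nil mulg1.
Qed.

Lemma ldescP i w : ldesc i w -> len w = (len (s i * w)).+1.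
Proof.
move=> d; rewrite -{1}[w](sKg i) ldescN // /ldesc sKg -leqNgt; exact: ltnW.
Qed.

Lemma rdescN i w : ~~ rdesc i w -> len (w * s i) = (len w).+1.
Proof. by rewrite -ldescV => /ldescN; rewrite -{1}(sV i) -invgM !lenV. Qed.

Lemma len_s i : len (s i) = 1%N.
Proof.
rewrite -[s i]mulg1 ldescN ?len1 //.
by rewrite /ldesc len1.
Qed.

Lemma reduced_cat u v : reduced (u ++ v) -> reduced u /\ reduced v.
Proof.
rewrite /reduced pi_cat size_cat => E.
have := lenM (pi u) (pi v); rewrite E => le.
have lu := len_le u; have lv := len_le v.
split; apply/eqP; rewrite eqn_leq ?lu ?lv //=.
  by rewrite -(leq_add2r (size v)) (leq_trans le) // leq_add2l.
by rewrite -(leq_add2l (size u)) (leq_trans le) // leq_add2r.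
Qed.

Lemma reduced_cons_ldesc i u : reduced (i :: u) -> ldesc i (pi (i :: u)).
Proof.
by move=> r; rewrite /ldesc r big_cons sKg ltnS len_le.
Qed.

(** The contragredient representation respects the relations; the braid relation comes from the
    order of [cox_rot]. *)
Lemma act_cong u v (f : I -> R) : cong (coxeter_rel m) u v ->
  foldr (cox_refl m) f u = foldr (cox_refl m) f v.
Proof.
move=> uv; elim: uv f => {u v} [a b u v uv|//|u v _ IH|u v w _ IH1 _ IH2] f; first 1 last.
- by rewrite IH.
- by rewrite IH1.
rewrite !foldr_cat; congr foldr; move: (foldr _ _ b) => {}f.
case: uv => [_ _ [i j n mij]|i]; last by rewrite /= cox_reflK.
have := cox_rot_iter_n m_coxeter mij.
case: n mij => [//|[|n]] mij per.
  case: m_coxeter => _ _ H; have ij : i = j by apply/H.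
  by rewrite ij.
(* Same identity as [prod_alt_expg], for operators: [alt k i j] acts as the [k]-th power of
   [cox_rot] applied after [alt k j i]. *)
rewrite -[RHS](per isT); elim: n.+2 i j {mij per} f => //= k IHk i j f.
rewrite (IHk j i) /=; congr cox_refl.
have rotS l (g : I -> R) : cox_refl m j (iter l (cox_rot m i j) g) =
   iter l (cox_rot m j i) (cox_refl m j g).
  by elim: l => //= l IHl; rewrite {1}/cox_rot IHl.
by rewrite rotS /cox_rot !cox_reflK.
Qed.

(** With [s_expg], this gives [s i * s j] order exactly [m i j]: a trivial power acts trivially on
    forms, where the order of [cox_rot] is known. *)
Lemma s_expg_dvd i j l : (0 < l)%N -> (s i * s j) ^+ l = 1 ->
  exists2 n, m i j = Some n & (n %| l)%N.
Proof.
move=> l0 E.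
have /act_cong A : cong (coxeter_rel m) (alt l.*2 i j) [::].
  by apply/pi_eqP; rewrite pi_alt prod_alt_double E big_nil.
have rotl f : iter l (cox_rot m i j) f = f.
  rewrite -[RHS](A f) /=; elim: (l) => //= k ->; by rewrite /cox_rot.
case mij: (m i j) => [n|]; last by rewrite (cox_rot_free m_coxeter mij rotl) in l0.
exists n => //.
case: n mij => [|[|n]] mij; last exact: (cox_rot_fix m_coxeter mij).
  by case: m_coxeter => _ /(_ i j).
exact: dvd1n.
Qed.

Lemma s_inj : injective s.
Proof.
move=> i j sij; have [//||n mij] := @s_expg_dvd i j 1.
  by rewrite expg1 sij sK.
rewrite dvdn1 => /eqP n1; case: m_coxeter => _ _ H; apply/H; by rewrite mij n1.
Qed.

End CoxeterWords.

(** * Concatenation, alternating words and subwords *)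

Lemma pclass_cat (X : Type) (R : seq X -> seq X -> Prop) u v :
  pclass R (u ++ v) = pclass R u * pclass R v.
Proof. by rewrite [RHS]pmulE. Qed.

Lemma cat_eq_cat_cons (T : Type) (u v u1 u2 : seq T) j :
  u ++ v = u1 ++ j :: u2 ->
  (exists2 u3, u = u1 ++ j :: u3 & u2 = u3 ++ v) \/
  (exists2 u3, u1 = u ++ u3 & v = u3 ++ j :: u2).
Proof.
elim: u u1 => [|x u IHu] [|y u1] //=; first by right; exists [::].
- by right; exists (y :: u1).
- by move=> [-> <-]; left; exists u.
- move=> [-> /IHu [[u3 -> ->]|[u3 -> ->]]]; first by left; exists u3.
  by right; exists u3.
Qed.

Lemma alt_cat (T : Type) k l (i j : T) :
  alt (k + l) i j = alt k i j ++ (if odd k then alt l j i else alt l i j).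
Proof. by elim: k i j => //= k IHk i j; rewrite IHk; case: (odd k). Qed.

Lemma alt_map (T T' : Type) (f : T -> T') k i j : map f (alt k i j) = alt k (f i) (f j).
Proof. by elim: k i j => //= k IHk i j; rewrite IHk. Qed.

Lemma size_alt (T : Type) k (i j : T) : size (alt k i j) = k.
Proof. by elim: k i j => //= k IHk i j; rewrite IHk. Qed.

Lemma finite_masks (T : Type) (u : seq T) : finite_set (range (fun b : bitseq => mask b u)).
Proof.
elim: u => [|x u IHu].
  by apply: (sub_finite_set _ (finite_set1 [::])) => _ [b _ <-]; rewrite mask0.
apply: (@sub_finite_set _ _ ([set [::]] `|` [set mask b u | b in setT] `|`
  (cons x @` [set mask b u | b in setT]))).
  move=> _ [[|[] b] _ <-] /=; first by do 2 left.
    by right; exists (mask b u) => //; exists b.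
  by left; right; exists b.
by rewrite !finite_setU; do !split => //; exact: finite_image.
Qed.

Lemma mask_delete (T : Type) (b : bitseq) (u u1 u2 : seq T) j :
  mask b u = u1 ++ j :: u2 -> exists b', mask b' u = u1 ++ u2.
Proof.
elim: u b u1 => [|x u IHu] [|[] b] [|y u1] //=.
- by move=> [_ <-]; exists (false :: b).
- by move=> [-> /IHu [b' <-]]; exists (true :: b').
- by move=> /(IHu _ [::]) [b' E]; exists (false :: b').
- by move=> /(IHu _ (y :: u1)) [b' E]; exists (false :: b').
Qed.

(** * Parabolic subgroups and the weak order *)

Section Parabolic.
Variables (I : Type) (m : cmatrix I).
Hypothesis m_coxeter : coxeter_matrix m.

Local Notation W := (coxeter_group m).
Local Notation s := (s_ m).
Local Notation pi u := (\prod_(i <- u) s_ m i).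
Local Notation len := (@length I m).
Local Notation rw := (@reduced_word I m).
Implicit Types (v w x y h : W) (J K : set I).

Definition additive v w := len (v * w) = (len v + len w)%N.

(** The right weak order: a reduced word of [v] extends to one of [w]. *)
Definition wprefix v w := exists2 x, w = v * x & additive v x.

Lemma additive_le v w : (len v + len w <= len (v * w)%g)%N -> additive v w.
Proof. by move=> le; apply/eqP; rewrite eqn_leq lenM. Qed.

Lemma additiveV v w : additive v w -> additive w^-1 v^-1.
Proof. by rewrite /additive -invgM !lenV addnC. Qed.

Lemma additive1g w : additive 1 w. Proof. by rewrite /additive mul1g len1. Qed.
Lemma additiveg1 w : additive w 1. Proof. by rewrite /additive mulg1 len1 addn0. Qed.

Lemma additive_assoc x y w : additive x y -> additive (x * y) w ->
  additive y w /\ additive x (y * w).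
Proof.
rewrite /additive => xy xyw.
have l1 := lenM x (y * w); have l2 := lenM y w; rewrite mulgA xyw xy in l1.
have yw : additive y w.
  by apply: additive_le; rewrite -(leq_add2l (len x)) addnA.
by split=> //; rewrite mulgA xyw xy yw addnA.
Qed.

Lemma additive_assocV x y w : additive y w -> additive x (y * w) ->
  additive x y /\ additive (x * y) w.
Proof.
move=> /additiveV + /additiveV; rewrite invgM => yw xyw.
have [/additiveV + /additiveV] := additive_assoc yw xyw.
by rewrite invgM !invgK.
Qed.

Lemma wprefix_refl v : wprefix v v.
Proof. by exists 1; [rewrite mulg1 | exact: additiveg1]. Qed.

Lemma wprefix_trans v w x : wprefix v w -> wprefix w x -> wprefix v x.
Proof.
move=> [y -> vy] [z -> vyz]; exists (y * z); first by rewrite mulgA.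
by case: (additive_assoc vy vyz).
Qed.

Lemma wprefix_len v w : wprefix v w -> (len v <= len w)%N.
Proof. by move=> [x -> ->]; exact: leq_addr. Qed.

Lemma wprefix_len_eq v w : wprefix v w -> (len w <= len v)%N -> v = w.
Proof.
move=> [x -> ->]; rewrite -[X in (_ <= X)%N -> _]addn0 leq_add2l leqn0.
by move=> /eqP /(@len_eq0 _ m) ->; rewrite mulg1.
Qed.

Lemma wprefix1 v : wprefix 1 v.
Proof. by exists v; [rewrite mul1g | exact: additive1g]. Qed.

Lemma wprefix_sP i w : wprefix (s i) w <-> ldesc i w.
Proof.
split=> [[x -> ix]|d].
  by rewrite /ldesc sKg ix len_s.
exists (s i * w); first by rewrite sKg.
by rewrite /additive sKg (ldescP m_coxeter d) len_s.
Qed.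

Lemma ldesc_wprefix i v w : wprefix v w -> ldesc i v -> ldesc i w.
Proof. by move=> vw /wprefix_sP iv; apply/wprefix_sP; exact: wprefix_trans vw. Qed.

Lemma additive_s i w : ~~ ldesc i w -> additive (s i) w.
Proof. by move=> /(ldescN m_coxeter); rewrite /additive len_s. Qed.

Lemma additive_sr w i : ~~ rdesc i w -> additive w (s i).
Proof. by move=> /(rdescN m_coxeter); rewrite /additive len_s // addn1. Qed.

Lemma reduced_cons i u : reduced m u -> ~~ ldesc i (pi u) -> reduced m (i :: u).
Proof. by move=> ru /(ldescN m_coxeter) l; rewrite /reduced big_cons l ru. Qed.

Lemma reduced_consN i u : reduced m (i :: u) -> ~~ ldesc i (pi u).
Proof.
move=> r; have /= [_ ru] := @reduced_cat _ m [:: i] u r.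
by move: r; rewrite /reduced big_cons => E; rewrite /ldesc -leqNgt ru E /= leqnSn.
Qed.

Lemma reduced_additive (u v : seq I) : reduced m u -> reduced m v ->
  additive (pi u) (pi v) -> reduced m (u ++ v).
Proof. by rewrite /reduced /additive pi_cat size_cat => -> -> ->. Qed.

Lemma additive_reduced (u v : seq I) : reduced m (u ++ v) -> additive (pi u) (pi v).
Proof.
move=> r; have [ru rv] := reduced_cat r.
by rewrite /additive -pi_cat r ru rv size_cat.
Qed.

Lemma reduce_word (P : pred I) u : all P u ->
  exists v : seq I, [/\ all P v, pi v = pi u & reduced m v].
Proof.
elim: u => [_|i u IHu /= /andP [Pi /IHu [v [Pv vE rv]]]].
  by exists [::]; split; rewrite // /reduced big_nil len1.
have [d|nd] := boolP (ldesc i (pi v)); last first.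
  by exists (i :: v); rewrite /= Pi Pv !big_cons vE; split=> //; exact: reduced_cons.
have [u1 [j [u2 [E Ed]]]] := exchange m_coxeter d.
exists (u1 ++ u2); rewrite big_cons -vE Ed; split=> //.
  by move: Pv; rewrite E !all_cat /= => /and3P [-> _].
have := rv; rewrite {1}/reduced (ldescP m_coxeter d) Ed E size_cat /= addnS => -[].
by rewrite /reduced size_cat.
Qed.

Lemma parabolicP J w : parabolic m J w <-> exists2 u, all (mem J) u & pi u = w.
Proof.
split=> [Jw|[u Ju <-]].
  apply: (Jw [set w | exists2 u, all (mem J) u & pi u = w]); split.
    split; first split.
    - by exists [::]; rewrite ?big_nil.
    - move=> _ _ [u Ju <-] [v Jv <-]; exists (u ++ v); last by rewrite pi_cat.
      by rewrite all_cat Ju.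
    - by move=> _ [u Ju <-]; exists (rev u); rewrite ?all_rev ?pi_rev.
  move=> _ [i Ji <-]; exists [:: i]; last by rewrite big_cons big_nil mulg1.
  by rewrite /= mem_set.
move=> A [[[A1 AM] _] JA]; elim: u Ju => [_|i u IHu /= /andP [Ji Ju]].
  by rewrite big_nil.
rewrite big_cons; apply: AM; last exact: IHu.
by apply: JA; exists i => //; exact: set_mem.
Qed.

Lemma parabolic_reduced J w : parabolic m J w ->
  exists u, [/\ all (mem J) u, pi u = w & reduced m u].
Proof. by move=> /parabolicP [u Ju <-]; exact: reduce_word. Qed.

Lemma parabolic1 J : parabolic m J 1.
Proof. by apply/parabolicP; exists [::]; rewrite ?big_nil. Qed.

Lemma parabolic_s J i : J i -> parabolic m J (s i).
Proof.
move=> Ji; apply/parabolicP; exists [:: i]; last by rewrite big_cons big_nil mulg1.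
by rewrite /= mem_set.
Qed.

Lemma parabolicM J v w : parabolic m J v -> parabolic m J w -> parabolic m J (v * w).
Proof.
move=> /parabolicP [u Ju <-] /parabolicP [u' Ju' <-]; apply/parabolicP.
by exists (u ++ u'); rewrite ?all_cat ?Ju ?pi_cat.
Qed.

Lemma parabolicV J v : parabolic m J v -> parabolic m J v^-1.
Proof.
move=> /parabolicP [u Ju <-]; apply/parabolicP.
by exists (rev u); rewrite ?all_rev ?pi_rev.
Qed.

Lemma parabolic_sub J K v : J `<=` K -> parabolic m J v -> parabolic m K v.
Proof.
move=> JK /parabolicP [u Ju <-]; apply/parabolicP; exists u => //.
by apply: sub_all Ju => i /set_mem /JK /mem_set.
Qed.

(** Exchange in a reduced word of [v] followed by one of [w]: the deleted letter lies in one part or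
    in the other. *)
Lemma exchange_additive i v w : additive v w -> ldesc i (v * w) ->
  ldesc i v \/ exists2 y, s i * v * w = v * y & (len y < len w)%N.
Proof.
move=> vw; rewrite -{1}[v](@rwK _ m) -{1}[w](@rwK _ m) -pi_cat => /(exchange m_coxeter).
move=> [u1 [j [u2 [E0 E]]]]; rewrite pi_cat !rwK in E.
case: (cat_eq_cat_cons E0) => [] [u3 E1 E2]; [left|right].
  have -> : v = v * w * w^-1 by rewrite mulgK.
  rewrite /ldesc mulgA E E2 catA pi_cat rwK !mulgK.
  by rewrite [X in (_ < X)%N](_ : _ = size (rw v)) // E1 size_cat /= addnS -size_cat ltnS len_le.
exists (pi (u3 ++ u2)); first by rewrite -mulgA E E1 -catA pi_cat rwK.
by rewrite [X in (_ < X)%N](_ : _ = size (rw w)) // E2 size_cat /= addnS -size_cat ltnS len_le.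
Qed.

(** Build [v] letter by letter. If [i] were a descent of [pi u * x] but not of [pi u], exchange
    would delete a letter of [x], making [(pi u)^-1 * s i * pi u * x] a shorter element of the
    coset. *)
Lemma parabolic_min_additive J x v :
    (forall y, parabolic m J y -> (len x <= len (y * x)%g)%N) ->
  parabolic m J v -> additive v x.
Proof.
move=> xmin /parabolic_reduced [u [Ju <- ru]] {v}.
elim: u Ju ru => [|i u IHu] /=; first by rewrite big_nil => _ _; exact: additive1g.
move=> /andP [/set_mem Ji Ju] r.
have [_ ru] := @reduced_cat _ m [:: i] u r.
have ux := IHu Ju ru; have nd := reduced_consN r.
suff nd' : ~~ ldesc i (pi u * x).
  have h1 := additive_s nd'; rewrite big_cons.
  by case: (additive_assocV ux h1).
apply/negP => /(exchange_additive ux) [d|[y E ly]]; first by rewrite d in nd.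
have Jy : parabolic m J ((pi u)^-1 * s i * pi u).
  have Jpu : parabolic m J (pi u) by apply/parabolicP; exists u.
  by apply: parabolicM => //; apply: parabolicM; [exact: parabolicV|exact: parabolic_s].
have := xmin _ Jy; rewrite leqNgt => /negP; apply.
by rewrite -!mulgA [s i * _]mulgA E mulKg.
Qed.

Lemma parabolic_decomp J w : exists v x,
  [/\ w = v * x, parabolic m J v & forall y, parabolic m J y -> additive y x].
Proof.
pose P k := `[< exists2 v, parabolic m J v & len (v * w) = k >].
have [|k /asboolP [v Jv <-] kmin] := @ex_minnP P.
  by exists (len w); apply/asboolP; exists 1; [exact: parabolic1|rewrite mul1g].
exists v^-1, (v * w); split; [by rewrite mulKg|exact: parabolicV|].
move=> y Jy; apply: parabolic_min_additive Jy => z Jz.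
by apply: kmin; apply/asboolP; exists (z * v); rewrite ?mulgA //; exact: parabolicM.
Qed.

(** Write [x = v0 * x0] with [x0] minimal in its coset: the first letter of a nontrivial [v0] would
    be a descent of [x]. *)
Lemma ldesc_free_additive J x v : (forall i, J i -> ~~ ldesc i x) ->
  parabolic m J v -> additive v x.
Proof.
have [v0 [x0 [-> Jv0 x0min]]] := parabolic_decomp J x.
have [u [Ju <- ru]] := parabolic_reduced Jv0.
case: u Ju ru => [|i u] /=; first by rewrite big_nil mul1g => _ _ _; exact: x0min.
move=> /andP [/set_mem Ji Ju] r /(_ _ Ji) /negP [].
apply: (@ldesc_wprefix _ (pi (i :: u))); last exact: reduced_cons_ldesc.
exists x0 => //; apply: x0min; apply/parabolicP; exists (i :: u) => //=.
by rewrite Ju mem_set.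
Qed.

Lemma rdesc_free_additive J x v : (forall i, J i -> ~~ rdesc i x) ->
  parabolic m J v -> additive x v.
Proof.
move=> nd Jv; rewrite -[x]invgK -[v]invgK; apply: additiveV.
apply: (@ldesc_free_additive J); last exact: parabolicV.
by move=> i Ji; rewrite ldescV; exact: nd.
Qed.

Definition full K w := forall i, K i -> ldesc i w.

Lemma full_decomp K w : full K w -> exists h x,
  [/\ w = h * x, additive h x, parabolic m K h & full K h].
Proof.
have [h [x [-> Kh xmin]]] := parabolic_decomp K w => d.
exists h, x; split=> //; first exact: xmin.
move=> i Ki; have := d i Ki; rewrite /ldesc mulgA !xmin ?ltn_add2r //.
by apply: parabolicM => //; exact: parabolic_s.
Qed.

(** If [h = pi u * y] and [i] is a descent of [h] but not of [pi u], exchange deletes a letter of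
    [y], so [i :: u] begins [h] as well. *)
Lemma full_wprefix K h v : full K h -> parabolic m K v -> wprefix v h.
Proof.
move=> fh /parabolic_reduced [u [Ku <- ru]] {v}.
elim: u Ku ru => [|i u IHu] /=; first by rewrite big_nil => _ _; exact: wprefix1.
move=> /andP [/set_mem Ki Ku] r.
have [_ ru] := @reduced_cat _ m [:: i] u r.
have nd := reduced_consN r; have [y hE uy] := IHu Ku ru.
have := fh i Ki; rewrite {1}hE => /(exchange_additive uy) [d|[z E lz]].
  by rewrite d in nd.
have {}E : h = pi (i :: u) * z by rewrite big_cons -mulgA -E -mulgA sKg.
exists z => //; apply: additive_le; rewrite -E hE uy r ru /= addSn -addnS.
by rewrite leq_add2l.
Qed.

(** The complement of a prefix is a subword of one fixed reduced word, so prefixes are finitely many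
    even when [I] is infinite. *)
Lemma wprefix_mask v w x : w = v * x -> additive v x -> exists b, x = pi (mask b (rw w)).
Proof.
rewrite -[v](@rwK _ m); move: (rw v) (reduced_rw v) => u.
elim/(@last_ind I): u x => [|u i IHu] x r.
  rewrite big_nil mul1g => -> _.
  by exists (nseq (size (rw x)) true); rewrite mask_true // rwK.
rewrite -cats1 in r *.
rewrite pi_cat big_cons big_nil mulg1 => wE uix.
have [ru _] := reduced_cat r.
have uis : additive (pi u) (s i).
  by have := additive_reduced r; rewrite big_cons big_nil mulg1.
have [ix uix'] := additive_assoc uis uix.
have [b bE] := IHu _ ru (etrans wE (esym (mulgA _ _ _))) uix'.
have : ldesc i (pi (mask b (rw w))) by rewrite -bE /ldesc sKg ix len_s.
move=> /(exchange m_coxeter) [u1 [j [u2 [E0 E]]]].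
have [b' b'E] := mask_delete E0.
by exists b'; rewrite b'E -E -bE sKg.
Qed.

Lemma finite_wprefixes w : finite_set [set v | wprefix v w].
Proof.
apply: (@sub_finite_set _ _
  ((fun u => w * (pi u)^-1) @` range (fun b => mask b (rw w)))).
  move=> v [x wE vx]; have [b bE] := wprefix_mask wE vx.
  by exists (mask b (rw w)); [exists b | rewrite -bE wE mulgK].
exact/finite_image/finite_masks.
Qed.

Lemma full_spherical K h : full K h -> spherical m K.
Proof.
by move=> fh; apply: (sub_finite_set _ (finite_wprefixes h)) => v; exact: full_wprefix.
Qed.

Lemma longest_parabolic K : spherical m K -> parabolic m K (longest m K).
Proof. by case/longestP. Qed.

Lemma longest_full K : spherical m K -> full K (longest m K).
Proof.
case/longestP => Kh hmax i Ki; apply: contraT => /(ldescN m_coxeter) E.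
have := hmax (s i * longest m K); rewrite E ltnn; apply.
by apply: parabolicM => //; exact: parabolic_s.
Qed.

Lemma longest_uniq_le K v : spherical m K -> parabolic m K v ->
  (len (longest m K) <= len v)%N -> v = longest m K.
Proof.
move=> sK Kv; apply: wprefix_len_eq; exact: (full_wprefix (longest_full sK) Kv).
Qed.

Lemma longest_uniq_full K h : parabolic m K h -> full K h -> h = longest m K.
Proof.
move=> Kh fh; have sK := full_spherical fh; apply: (longest_uniq_le sK Kh).
exact: (wprefix_len (full_wprefix fh (longest_parabolic sK))).
Qed.

Lemma longestV K : spherical m K -> (longest m K)^-1 = longest m K.
Proof.
move=> sK; apply: longest_uniq_le => //; last by rewrite lenV.
exact: (parabolicV (longest_parabolic sK)).
Qed.

Lemma longestK K : spherical m K -> longest m K * longest m K = 1.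
Proof. by move=> sK; rewrite -{1}longestV // mulVg. Qed.

(** * Dihedral subgroups and Tits' theorem *)

Lemma reduced_alt_word i j u : reduced m u -> all (mem [set i; j]) u ->
  u = alt (size u) i j \/ u = alt (size u) j i.
Proof.
have side k l (x : I) (u' : seq I) : reduced m (x :: u') -> u' = alt (size u') k l ->
    x = k \/ x = l -> x :: u' = alt (size u').+1 k l \/ x :: u' = alt (size u').+1 l k.
  move=> r u'E [xk|->]; last by right; rewrite /= -u'E.
  left; rewrite xk in r *; case: u' r u'E => //= y u' r [yk _].
  have := r; rewrite yk /reduced !big_cons sKg => E.
  by have := len_le m u'; rewrite E /= ltnNge leqnSn.
elim: u => [|x u IHu] r /=; first by left.
move=> /andP [/set_mem xij all_u].
have [_ ru] := @reduced_cat _ m [:: x] u r.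
case: (IHu ru all_u) => E; first exact: side r E xij.
have xji : x = j \/ x = i by case: xij; [right|left].
by case: (side _ _ _ _ r E xji); [right|left].
Qed.

(** By [s_expg_dvd] the label [n] divides [k]. If [n < k], a braid move on the last [n] letters of
    [alt n.+1 i j] puts two letters [i] side by side, against reducedness. *)
Lemma alt_eq_order i j k : i <> j -> (0 < k)%N -> reduced m (alt k i j) ->
  pi (alt k i j) = pi (alt k j i) -> m i j = Some k.
Proof.
move=> ij k0 r E.
have kE : (s i * s j) ^+ k = 1.
  by apply/prod_altC; rewrite ?sK // -!pi_alt.
have [n mij nk] := s_expg_dvd m_coxeter k0 kE.
have := dvdn_leq k0 nk; rewrite leq_eqVlt => /predU1P [<- //|nltk].
have := r; rewrite -(subnKC nltk) alt_cat => /reduced_cat [+ _].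
rewrite /reduced /= size_alt big_cons (@pi_braid _ _ _ _ n) ?mij; last first.
  by case: m_coxeter => ->.
case: n {nk nltk} mij => [|n] mij; first by case: m_coxeter => _ /(_ i j).
rewrite /= big_cons sKg => l.
by have := len_le m (alt n j i); rewrite l size_alt ltnNge leqnSn.
Qed.

(** The dihedral factor [h] of [w] keeps both descents. Its reduced words starting with [i] and with
    [j] both alternate and have the same length, which is then the label. *)
Lemma ldesc_dihedral i j w : i <> j -> ldesc i w -> ldesc j w ->
  exists n, [/\ m i j = Some n, reduced m (alt n i j) & wprefix (pi (alt n i j)) w].
Proof.
move=> ij di dj.
have [|h [x [wE hx Kh fh]]] := @full_decomp [set i; j] w.
  by move=> _ [] ->.
have start (k l : I) : k <> l -> ([set k; l] = [set i; j]) ->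
    exists n, [/\ pi (alt n k l) = h, reduced m (alt n k l) & (0 < n)%N].
  move=> nkl kl; have Kk : [set i; j] k by rewrite -kl; left.
  have Kskh : parabolic m [set i; j] (s k * h).
    by apply: parabolicM => //; exact: parabolic_s.
  have [u [Ku uE ru]] := parabolic_reduced Kskh.
  have uEh : pi (k :: u) = h by rewrite big_cons uE sKg.
  have rku : reduced m (k :: u).
    by apply: reduced_cons => //; rewrite uE /ldesc sKg -leqNgt ltnW //; exact: fh.
  have Kku : all (mem [set k; l]) (k :: u) by rewrite kl /= mem_set.
  case: (reduced_alt_word rku Kku) => E; last by case: E => /nkl.
  by exists (size u).+1; rewrite -[_.+1]/(size (k :: u)) -E.
have [n [nE rn n0]] := start i j ij erefl.
have [n' [nE' rn' _]] := start j i (fun ji => ij (esym ji)) (setUC _ _).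
have nn' : n' = n by rewrite -(size_alt n j i) -(size_alt n' j i) -rn' nE' -nE rn !size_alt.
exists n; split=> //; last by exists x; rewrite nE.
by apply: alt_eq_order; rewrite // nE -nn' nE'.
Qed.

(** If a reduced alternating word of fewer than [n] letters could not be extended, its element would
    have both descents, hence a prefix of length [n]. *)
Lemma reduced_alt i j n : m i j = Some n -> reduced m (alt n i j).
Proof.
move=> mij; case: (pselect (i = j)) => [ij|ij].
  have {mij} -> : n = 1%N.
    by case: m_coxeter => _ _ /(_ i j) [_ /(_ ij)]; rewrite mij => -[].
  by rewrite /reduced big_cons big_nil mulg1 len_s.
suff H k : (k <= n)%N -> reduced m (alt k i j) /\ reduced m (alt k j i).
  by case: (H n (leqnn n)).
have step l (x y : I) : x <> y -> m x y = Some n -> (l < n)%N ->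
    reduced m (alt l y x) -> reduced m (alt l.+1 x y).
  move=> xy mxy ln r; rewrite /=; apply: reduced_cons => //.
  apply/negP => dx.
  case: l ln r dx => [|l] ln r dx; first by move: dx; rewrite /ldesc /= big_nil len1.
  have dy := reduced_cons_ldesc r.
  have [n' [mxy' rn' /wprefix_len]] := ldesc_dihedral xy dx dy.
  by move: mxy'; rewrite mxy r rn' !size_alt => -[<-]; rewrite leqNgt ln.
elim: k => [_|k IHk ltkn]; first by rewrite /= /reduced big_nil len1.
have [r1 r2] := IHk (ltnW ltkn).
have mji : m j i = Some n by case: m_coxeter => ->.
by split; apply: step => // /esym.
Qed.

(** Tits' theorem, by induction on length. Words with distinct first letters are linked through the
    two sides of a braid relation, each sharing its first letter with one of the words. *)
Lemma reduced_cong (u v : seq I) : reduced m u -> reduced m v -> pi u = pi v ->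
  cong (braid_rel m) u v.
Proof.
move: {2}(size u) (leqnn (size u)) => k; elim: k u v => [|k IHk] [|i u] v //= le ru rv E.
- have -> : v = [::]; last exact: CongRefl.
  by apply: size0nil; rewrite -rv -E big_nil len1.
- have -> : v = [::]; last exact: CongRefl.
  by apply: size0nil; rewrite -rv -E big_nil len1.
case: v rv E => [|j v] rv E; first by have := ru; rewrite /reduced E big_nil len1.
have consE l (v1 v2 : seq I) : (size v1 <= k)%N -> reduced m (l :: v1) -> reduced m (l :: v2) ->
    pi (l :: v1) = pi (l :: v2) -> cong (braid_rel m) (l :: v1) (l :: v2).
  move=> lek r1 r2; rewrite !big_cons => /mulgI E12.
  have [_ r1'] := @reduced_cat _ m [:: l] v1 r1.
  have [_ r2'] := @reduced_cat _ m [:: l] v2 r2.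
  by apply: (@cong_cat _ _ [:: l] [:: l]); [exact: CongRefl | exact: IHk].
have suv : size u = size v.
  by have := ru; rewrite /reduced E rv => -[].
case: (pselect (i = j)) => [ij|ij]; first by rewrite -ij in rv E *; exact: consE.
have di := reduced_cons_ldesc ru.
have dj := reduced_cons_ldesc rv; rewrite -E in dj.
have [n [mij rn [x wE nx]]] := ldesc_dihedral ij di dj.
have mji : m j i = Some n by case: m_coxeter => ->.
have rn' := reduced_alt mji.
have bE := pi_braid mij.
have n0 : (0 < n)%N by case: (n) mij => //; case: m_coxeter => _ /(_ i j).
have rnx : reduced m (alt n i j ++ rw x).
  by apply: reduced_additive => //; [exact: reduced_rw|rewrite rwK].
have rnx' : reduced m (alt n j i ++ rw x).
  by apply: reduced_additive => //; [exact: reduced_rw|rewrite rwK -bE].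
apply: (@CongTrans _ _ _ (alt n i j ++ rw x)).
  have := rnx; have : pi (alt n i j ++ rw x) = pi (i :: u) by rewrite pi_cat rwK.
  by case: (n) n0 => // n1 _ /= E1 r1; apply: consE.
apply: (@CongTrans _ _ _ (alt n j i ++ rw x)).
  exact: (@CongRel _ _ [::] (rw x) _ _ (BraidRel mij)).
have := rnx'; have : pi (alt n j i ++ rw x) = pi (j :: v) by rewrite pi_cat rwK -bE -wE.
case: (n) n0 => // n1 _ /= E1 r1; apply: CongSym; apply: consE => //.
by rewrite -suv.
Qed.

Local Notation L := (@artin_lift I m).

Lemma lift_reduced u : reduced m u -> L (pi u) = pclass (braid_rel m) u.
Proof.
move=> ru; rewrite /artin_lift prod_pgen; apply/pclassP; apply: reduced_cong => //.
  exact: reduced_rw.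
by rewrite rwK.
Qed.

Lemma lift1 : L 1 = 1.
Proof. by have := @lift_reduced [::]; rewrite /reduced big_nil len1 => ->. Qed.

Lemma lift_s i : L (s i) = artin_mgen m i.
Proof.
have := @lift_reduced [:: i]; rewrite /reduced big_cons big_nil mulg1 len_s //.
by move=> ->.
Qed.

Lemma liftM v w : additive v w -> L (v * w) = L v * L w.
Proof.
move=> vw; rewrite -[v](@rwK _ m) -[w](@rwK _ m) -pi_cat !lift_reduced ?pclass_cat //; 
  try exact: reduced_rw.
by apply: reduced_additive; rewrite ?rwK //; exact: reduced_rw.
Qed.

End Parabolic.

(** * Left divisibility, and word length in the positive monoid *)

Definition mdiv (M : monoidType) (a b : M) := exists c, b = a * c.

Lemma mdivMr (M : monoidType) (a b c : M) : mdiv (a * b) c -> mdiv a c.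
Proof. by move=> [d ->]; exists (b * d); rewrite mulgA. Qed.

Lemma mdiv_trans (M : monoidType) (a b c : M) : mdiv a b -> mdiv b c -> mdiv a c.
Proof. by move=> [x ->] /mdivMr. Qed.

Section ArtinSize.
Variables (I : Type) (m : cmatrix I).

Local Notation B := (artin_monoid m).
Local Notation gen := (artin_mgen m).
Local Notation cls := (pclass (braid_rel m)).

(** Read on the chosen representative; braid relations preserve size, so any word of [b] gives the
    same value. *)
Definition bsize (b : B) : nat := size (pword b).

Lemma bsize_cls u : bsize (cls u) = size u.
Proof.
have: cong (braid_rel m) (pword (cls u)) u by apply/pclassP; rewrite pwordK.
rewrite /bsize; move: (pword _) => w; elim=> {w u} [a b _ _ [i j n _]|//|//|_ _ _ _ -> _ -> //].
by rewrite !size_cat !size_alt.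
Qed.

Lemma cls_cons i u : cls (i :: u) = gen i * cls u.
Proof. exact: (pclass_cat _ [:: i]). Qed.

Lemma cls_ind (P : B -> Prop) : P 1 -> (forall i b, P b -> P (gen i * b)) -> forall b, P b.
Proof.
move=> P1 PS b; rewrite -[b]pwordK; elim: (pword b) => // i u IHu.
by rewrite cls_cons; exact: PS.
Qed.

Lemma bsizeM (a b : B) : bsize (a * b) = (bsize a + bsize b)%N.
Proof. by rewrite -[a]pwordK -[b]pwordK -pclass_cat !bsize_cls size_cat. Qed.

Lemma bsize1 : bsize 1 = 0%N. Proof. exact: (bsize_cls [::]). Qed.

Lemma bsize_gen i : bsize (gen i) = 1%N. Proof. exact: (bsize_cls [:: i]). Qed.

Lemma cls_case (b : B) : b = 1 \/ exists i c, b = gen i * c.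
Proof.
rewrite -[b]pwordK; case: (pword b) => [|i u]; first by left.
by right; exists i, (cls u); rewrite cls_cons.
Qed.

End ArtinSize.

(** * Cancellation and joins in the positive monoid *)

Section ArtinMonoid.
Variables (I : Type) (m : cmatrix I).
Hypothesis m_coxeter : coxeter_matrix m.

Local Notation W := (coxeter_group m).
Local Notation s := (s_ m).
Local Notation pi u := (\prod_(i <- u) s_ m i).
Local Notation len := (@length I m).
Local Notation L := (@artin_lift I m).
Local Notation B := (artin_monoid m).
Local Notation gen := (artin_mgen m).
Local Notation cls := (pclass (braid_rel m)).

Lemma bsize_lift w : bsize (L w) = len w.
Proof.
rewrite -{1}[w](@rwK _ m) lift_reduced //; last exact: reduced_rw.
by rewrite bsize_cls.
Qed.

Lemma wprefix_step (z p : W) : wprefix z p ->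
  z = p \/ exists2 i, ~~ rdesc i z & wprefix (z * s i) p.
Proof.
move=> [x -> zx]; have := rwK x; have := reduced_rw x.
case: (reduced_word x) => [|i u] r xE; first by left; rewrite -xE big_nil mulg1.
right; have iu := @additive_reduced _ m [:: i] u r.
rewrite -xE big_cons in zx *; rewrite big_cons big_nil mulg1 in iu.
have [zi ziu] := additive_assocV iu zx.
exists i; last by exists (pi u); rewrite ?mulgA.
by rewrite /rdesc zi -leqNgt leq_addr.
Qed.

(* Newman's lemma: local joins suffice for a set of elements of bounded length
   to be directed. *)
Lemma wprefix_directed (P : W -> Prop) N :
    (forall z p, wprefix z p -> P p -> P z) ->
    (forall z, P z -> (len z <= N)%N) ->
    (forall z i j, P z -> ~~ rdesc i z -> ~~ rdesc j z ->
       P (z * s i) -> P (z * s j) ->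
       exists h, [/\ P h, wprefix (z * s i) h & wprefix (z * s j) h]) ->
  forall p q, P p -> P q -> exists h, [/\ P h, wprefix p h & wprefix q h].
Proof.
move=> Pclosed Pbound Pjoin.
(* Induction on [k], which bounds the room left above the common prefix [z], as [P] holds only up to
   length [N]. *)
suff H k z : (N < len z + k)%N -> P z -> forall p q, wprefix z p -> wprefix z q ->
    P p -> P q -> exists h, [/\ P h, wprefix p h & wprefix q h].
  move=> p q Pp Pq; have P1 := Pclosed _ _ (wprefix1 p) Pp.
  by apply: (H N.+1 1); rewrite ?len1 //; exact: wprefix1.
elim: k z => [|k IHk] z.
  by rewrite addn0 ltnNge => /negP NN /Pbound /NN.
move=> Nlt Pz p q zp zq Pp Pq.
have [<-|[i ndi zip]] := wprefix_step zp.
  by exists q; split=> //; exact: wprefix_refl.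
have [<-|[j ndj zjq]] := wprefix_step zq.
  by exists p; split=> //; exact: wprefix_refl.
have Pzi := Pclosed _ _ zip Pp; have Pzj := Pclosed _ _ zjq Pq.
have [h [Ph zih zjh]] := Pjoin _ _ _ Pz ndi ndj Pzi Pzj.
have lk l : ~~ rdesc l z -> (N < len (z * s l)%g + k)%N.
  by move=> /(rdescN m_coxeter) ->; rewrite addSnnS.
have [h1 [Ph1 ph1 hh1]] := IHk _ (lk _ ndi) Pzi p h zip zih Pp Ph.
have [h2 [Ph2 h1h2 qh2]] := IHk _ (lk _ ndj) Pzj h1 q (wprefix_trans zjh hh1) zjq Ph1 Pq.
by exists h2; split=> //; exact: wprefix_trans h1h2.
Qed.

Definition comeet i j (x y : B) := exists h b,
  [/\ ldesc i h, ldesc j h, x = L (s i * h) * b & y = L (s j * h) * b].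

Definition comeet_upto n := forall i j (x y : B), (bsize x < n)%N ->
  gen i * x = gen j * y -> comeet i j x y.

Section Upto.
Variable n : nat.
Hypothesis Rn : comeet_upto n.

(** When [i = j], the two expressions given by [comeet] coincide: this cancels one generator. *)
Lemma mulIgl_upto (a x y : B) : (bsize (a * x)%g <= n)%N -> a * x = a * y -> x = y.
Proof.
elim/cls_ind: a => [|i a IHa]; first by rewrite !mul1g.
rewrite -!mulgA => le E; rewrite bsizeM bsize_gen in le.
have [h [b [_ _ E1 E2]]] := Rn le E.
by apply: IHa; [exact: ltnW | rewrite E1 E2].
Qed.

(** Newman's lemma for the divisors [L z] of [b] that stay reduced after a fixed left factor [x];
    local joins come from [Rn] once [L z] is cancelled. *)
Lemma lift_join_upto (b : B) (x p q : W) : (bsize b <= n)%N ->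
    mdiv (L p) b -> additive x p -> mdiv (L q) b -> additive x q ->
  exists h, [/\ mdiv (L h) b, additive x h, wprefix p h & wprefix q h].
Proof.
move=> bn pb xp qb xq.
pose P z := mdiv (L z) b /\ additive x z.
suff [h [[h1 h2] h3 h4]] : exists h, [/\ P h, wprefix p h & wprefix q h] by exists h.
apply: (@wprefix_directed P n) => //.
- move=> z _ [y -> zy] [+ xzy]; rewrite liftM // => /mdivMr zb; split=> //.
  by case: (additive_assocV zy xzy).
- move=> z [[c bE] _]; rewrite -bsize_lift; apply: leq_trans bn.
  by rewrite bE bsizeM leq_addr.
move=> z i j [[c bE] xz] ndi ndj [[ci biE] xzi] [[cj bjE] xzj].
have zi := additive_sr m_coxeter ndi; have zj := additive_sr m_coxeter ndj.
rewrite (liftM m_coxeter zi) lift_s // -mulgA in biE.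
rewrite (liftM m_coxeter zj) lift_s // -mulgA in bjE.
have cE : gen i * ci = gen j * cj.
  by apply: (@mulIgl_upto (L z)); rewrite -?biE.
have lci : (bsize ci < n)%N.
  apply: leq_trans bn; rewrite biE !bsizeM bsize_gen add1n addnS ltnS.
  exact: leq_addl.
have [h [d [di dj ciE cjE]]] := Rn lci cE.
(* Only the dihedral part [g] of [h] is appended: neither [z] nor [x * z] has [i] or [j] as a right
   descent, so both multiply it additively. *)
have [|g [y [hE gy Kg fg]]] := @full_decomp _ m m_coxeter [set i; j] h.
  by move=> _ [] ->.
have zg : additive z g.
  by apply: (rdesc_free_additive m_coxeter _ Kg) => _ [] ->.
have asl l : ~~ rdesc l z -> additive x (z * s l) -> ~~ rdesc l (x * z).
  move=> ndl xzl; have [_ xz_l] := additive_assocV (additive_sr m_coxeter ndl) xzl.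
  by rewrite /rdesc xz_l -leqNgt leq_addr.
have xzg : additive (x * z) g.
  by apply: (rdesc_free_additive m_coxeter _ Kg) => _ [] ->; exact: asl.
have pre l : [set i; j] l -> wprefix (z * s l) (z * g).
  move=> /fg /wprefix_sP [//|g' gE lg']; exists g'; first by rewrite gE mulgA.
  by move: zg; rewrite gE => /(additive_assocV lg') [].
exists (z * g); split; last 2 first.
- by apply: pre; left.
- by apply: pre; right.
split; last by case: (additive_assoc xz xzg).
rewrite liftM //; exists (L y * d).
have hiE : L h = gen i * L (s i * h).
  have nd : ~~ ldesc i (s i * h) by rewrite /ldesc sKg -leqNgt ltnW.
  by rewrite -lift_s // -liftM ?sKg //; exact: additive_s.
by rewrite biE ciE [gen i * _]mulgA -hiE hE liftM // !mulgA.
Qed.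

End Upto.

Lemma comeet_all n : comeet_upto n.
Proof.
elim: n => [|n IHn] // i j x y.
rewrite -[x]pwordK -[y]pwordK bsize_cls ltnS -!cls_cons.
move: (pword x) (pword y) => {x y} u v ln /pclassP.
have [w wE] : exists w, w = i :: u by exists (i :: u).
have [w' wE'] : exists w, w = j :: v by exists (j :: v).
rewrite -wE -wE' => ww'; elim: ww' i j u v ln wE wE' => {w w'}.
(* A move away from the front leaves a common first letter [c], and [h = s c] serves; a move at the
   front takes the alternating element for [h]. *)
- move=> [|c a] b u v uv i j u' v' ln; last first.
    case: uv => k l r mkl [<- <-] [<- <-]; exists (s c), (cls (a ++ alt r k l ++ b)).
    rewrite sK (lift1 m_coxeter) !mul1g /ldesc sK len1 len_s //; split=> //.
    by apply/pclassP/CongRel/BraidRel; case: m_coxeter => ->.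
  case: uv => k l r mkl.
  have mlk : m l k = Some r by case: m_coxeter => ->.
  have rkl := reduced_alt m_coxeter mkl; have rlk := reduced_alt m_coxeter mlk.
  have E := pi_braid mkl.
  case: r mkl mlk rkl rlk E => [|r] mkl mlk; first by case: m_coxeter => _ /(_ k l).
  rewrite /= => rkl rlk E [<- <-] [<- <-].
  exists (pi (k :: alt r l k)), (cls b); split.
  - exact: reduced_cons_ldesc.
  - by rewrite E; exact: reduced_cons_ldesc.
  - rewrite big_cons sKg lift_reduced ?pclass_cat //.
    by case: (@reduced_cat _ m [:: k] _ rkl).
  - rewrite E big_cons sKg lift_reduced ?pclass_cat //.
    by case: (@reduced_cat _ m [:: l] _ rlk).
- move=> w i j u v ln -> [<- <-]; exists (s i), (cls u).
  by rewrite sK (lift1 m_coxeter) !mul1g /ldesc sK len1 len_s.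
- move=> w w' ww' IH i j u v ln E E'.
  have sz : size v = size u.
    have : cls w' = cls w by apply/pclassP; exact: CongSym.
    by rewrite E E' => /(congr1 (@bsize _ _)); rewrite !bsize_cls => -[].
  have [|h [b [h1 h2 h3 h4]]] := IH j i v u _ E' E; first by rewrite sz.
  by exists h, b.
(* The middle word is some [k :: z]. Both [s k * h1] and [s k * h2] lift to divisors of [z]; with
   [h0] their join, kept reduced after [s k], the merged element is [s k * h0]. *)
move=> w1 w2 w3 w12 IH1 w23 IH2 i j u v ln E1 E3.
have : size w2 = size w1.
  have : cls w1 = cls w2 by exact/pclassP.
  by move=> /(congr1 (@bsize _ _)); rewrite !bsize_cls.
case: w2 w12 IH1 w23 IH2 => [|k z] w12 IH1 w23 IH2; rewrite E1 //= => -[sz].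
have lz : (size z <= n)%N by rewrite sz.
have [h1 [b1 [di dk uE zE]]] := IH1 _ _ _ _ ln E1 erefl.
have [h2 [b2 [dk' dj zE' vE]]] := IH2 _ _ _ _ lz erefl E3.
have addk h : ldesc k h -> additive (s k) (s k * h).
  by move=> d; apply: additive_s => //; rewrite /ldesc sKg -leqNgt ltnW.
have [|||||h0 [[b' zE0] kh0 ph0 qh0]] :=
    @lift_join_upto n IHn (cls z) (s k) (s k * h1) (s k * h2).
- by rewrite bsize_cls.
- by exists b1.
- exact: addk.
- by exists b2.
- exact: addk.
(* Enlarging [h] to [s k * h0] keeps the descent [l]; cancelling [L (s k * h)] in [z] replaces the
   remainder by the common [b']. *)
have ext l h b (t : B) : ldesc l h -> ldesc k h -> wprefix (s k * h) h0 -> t = L (s l * h) * b ->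
    cls z = L (s k * h) * b -> ldesc l (s k * h0) /\ t = L (s l * (s k * h0)) * b'.
  move=> dl dkh [p h0E hp] -> zb.
  have khp : additive h p.
    move: kh0; rewrite h0E => kh0.
    by have [_] := additive_assocV hp kh0; rewrite sKg.
  have lhp : additive (s l * h) p.
    have lh : additive (s l) (s l * h).
      by apply: additive_s => //; rewrite /ldesc sKg -leqNgt ltnW.
    have : additive (s l * (s l * h)) p by rewrite sKg.
    by case/(additive_assoc lh).
  have E : s k * h0 = h * p by rewrite h0E mulgA sKg.
  rewrite E; split.
    by apply: ldesc_wprefix dl => //; exists p.
  rewrite [s l * (h * p)]mulgA (liftM m_coxeter lhp) -mulgA; congr (_ * _).
  apply: (@mulIgl_upto n IHn (L (s k * h))); first by rewrite -zb bsize_cls.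
  by rewrite -zb zE0 h0E (liftM m_coxeter hp) mulgA.
exists (s k * h0), b'.
have [d1 e1] := ext _ _ _ _ di dk ph0 uE zE.
by have [d2 e2] := ext _ _ _ _ dj dk' qh0 vE zE'.
Qed.

Lemma artin_mulIgl (a x y : B) : a * x = a * y -> x = y.
Proof. exact: (mulIgl_upto (@comeet_all (bsize (a * x))) (leqnn _)). Qed.

(** A divisor [L h] of [b] with [h] of maximal length absorbs its join with each [s i], so [h] is
    full; its factor in the parabolic subgroup of [K] is the longest element. *)
Lemma mdiv_longest (K : set I) (b : B) : (forall i, K i -> mdiv (gen i) b) ->
  spherical m K /\ mdiv (artin_longest m K) b.
Proof.
move=> Kb.
pose P k := `[< exists2 h, mdiv (L h) b & len h = k >].
have [||k /asboolP [h hb <-] hmax] := @ex_maxnP P (bsize b).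
- by exists 0%N; apply/asboolP; exists 1; [exists b; rewrite (lift1 m_coxeter) mul1g | exact: len1].
- move=> k /asboolP [h [c ->] <-]; rewrite -bsize_lift bsizeM; exact: leq_addr.
have fh : full K h.
  move=> i /Kb; rewrite -lift_s // => ib.
  have [h' [h'b _ ih' hh']] := lift_join_upto (@comeet_all _) (leqnn _)
    ib (additive1g _) hb (additive1g _).
  have -> : h = h'.
    by apply: wprefix_len_eq => //; apply: hmax; apply/asboolP; exists h'.
  exact/wprefix_sP.
have [g [y [hE gy Kg fg]]] := full_decomp m_coxeter fh.
have sK := full_spherical m_coxeter fg; split=> //.
rewrite /artin_longest -(longest_uniq_full m_coxeter Kg fg).
by apply: (@mdivMr _ _ (L y)); rewrite -(liftM m_coxeter gy) -hE.
Qed.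

End ArtinMonoid.

(** * Orders of group elements *)

Section Order.
Variable H : groupType.
Implicit Types x y : H.

Lemma gorderP x k : (0 < k)%N -> x ^+ k = 1 ->
  (forall n, (0 < n)%N -> x ^+ n = 1 -> (k <= n)%N) -> gorder x = Some k.
Proof.
move=> k0 xk kmin; rewrite /gorder; case: pselect => [ex|]; last first.
  by case; exists k; rewrite k0 xk eqxx.
case: ex_minnP => n /andP [n0 /eqP xn] nmin; congr Some; apply/eqP.
by rewrite eqn_leq kmin // nmin // k0 xk eqxx.
Qed.

Lemma gorder_Some x k : gorder x = Some k -> (0 < k)%N /\ x ^+ k = 1.
Proof.
rewrite /gorder; case: pselect => // ex [<-].
by case: ex_minnP => n /andP [n0 /eqP xn] _.
Qed.

Lemma gorder_min x k n : gorder x = Some k -> (0 < n)%N -> x ^+ n = 1 -> (k <= n)%N.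
Proof.
rewrite /gorder; case: pselect => // ex [<-] n0 xn.
by case: ex_minnP => l _; apply; rewrite n0 xn eqxx.
Qed.

Lemma gorder_None x n : gorder x = None -> (0 < n)%N -> x ^+ n <> 1.
Proof.
by rewrite /gorder; case: pselect => // nex _ n0 xn; case: nex; exists n; rewrite n0 xn eqxx.
Qed.

Lemma gorderV x : gorder x^-1 = gorder x.
Proof.
have xV n : x^-1 ^+ n = 1 <-> x ^+ n = 1.
  by rewrite expVgn; split=> [/eqP|->]; rewrite ?invg1 // invg_eq1 => /eqP.
case E: (gorder x) => [k|].
  have [k0 xk] := gorder_Some E; apply: gorderP; rewrite ?xV // => n n0.
  by rewrite xV; exact: gorder_min.
case E' : (gorder x^-1) => [k|//].
have [k0] := gorder_Some E'; rewrite xV.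
by move/(gorder_None E k0).
Qed.

End Order.

(** * The action of diagram automorphisms *)

Section DiagramAction.
Variables (I : Type) (m : cmatrix I).
Hypothesis m_coxeter : coxeter_matrix m.

Local Notation W := (coxeter_group m).
Local Notation s := (s_ m).
Local Notation pi u := (\prod_(i <- u) s_ m i).
Local Notation len := (@length I m).
Local Notation L := (@artin_lift I m).
Local Notation cls := (pclass (braid_rel m)).

(** Exchange puts [s i] in the parabolic subgroup of [J]; a reduced word of it over [J] has one
    letter, which is [i] by [s_inj]. *)
Lemma parabolic_ldesc (J : set I) i w : parabolic m J w -> ldesc i w -> J i.
Proof.
move=> /parabolicP [u Ju <-] /(exchange m_coxeter) [u1 [j [u2 [uE E]]]].
have Jsi : parabolic m J (s i).
  rewrite -[s i](mulgK (pi u)) E; apply: parabolicM.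
    apply/parabolicP; exists (u1 ++ u2) => //.
    by move: Ju; rewrite uE !all_cat /= => /and3P [-> _].
  by apply: parabolicV; apply/parabolicP; exists u.
have [[|k [|l v]] [Jk kE]] := parabolic_reduced m_coxeter Jsi; rewrite /reduced kE len_s //.
move: kE; rewrite big_cons big_nil mulg1 => /(s_inj m_coxeter) <- _.
by move: Jk => /= /andP [/set_mem].
Qed.

Lemma artin_mact_cls f u : Aut m f -> artin_mact f (cls u) = cls (map f u).
Proof.
move=> [_ fm]; rewrite /artin_mact pextend_class.
  by rewrite -prod_pgen big_map.
move=> _ _ [i j n mij]; rewrite -!(big_map f xpredT (@artin_mgen _ m)) !prod_pgen !map_alt.
have mfij : m (f i) (f j) = Some n by rewrite fm.
by apply/pclassP; have := @CongRel _ _ [::] [::] _ _ (BraidRel mfij); rewrite /= !cats0.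
Qed.

Definition wact (f : I -> I) (w : W) : W := pi (map f (reduced_word w)).

Section OneAut.
Variable f : I -> I.
Hypothesis fA : Aut m f.

Lemma wact_pi u : wact f (pi u) = pi (map f u).
Proof.
apply/pi_eqP; have /pi_eqP := rwK (pi u); move: (reduced_word _) => v.
elim=> {u v} [a b r r' rr'|r|r r' _|r1 r2 r3 _ h1 _ h2].
- rewrite !map_cat; apply: CongRel; case: rr' => [_ _ [i j n mij]|i] /=.
    by rewrite !map_alt; apply/CoxeterBraid/BraidRel; case: fA => _ ->.
  exact: CoxeterSquare.
- exact: CongRefl.
- exact: CongSym.
- exact: CongTrans h1 h2.
Qed.

Lemma wact1 : wact f 1 = 1.
Proof. by have := wact_pi [::]; rewrite !big_nil. Qed.

Lemma wact_s i : wact f (s i) = s (f i).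
Proof. by have := wact_pi [:: i]; rewrite !big_cons !big_nil !mulg1. Qed.

Lemma wactM v w : wact f (v * w) = wact f v * wact f w.
Proof.
by rewrite -[v](@rwK _ m) -[w](@rwK _ m) -pi_cat !wact_pi map_cat pi_cat.
Qed.

Lemma wact_len_le w : (len (wact f w) <= len w)%N.
Proof. by apply: leq_trans (len_le _ _) _; rewrite size_map. Qed.

End OneAut.

Lemma Aut_inv f : Aut m f -> exists g, [/\ Aut m g, cancel f g & cancel g f].
Proof.
move=> [[g fK gK] fm]; exists g; split=> //; split; first by exists f.
by move=> i j; rewrite -fm !gK.
Qed.

Lemma wact_len f w : Aut m f -> len (wact f w) = len w.
Proof.
move=> fA; have [g [gA fK gK]] := Aut_inv fA.
apply/eqP; rewrite eqn_leq wact_len_le //=.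
have {1}<- : wact g (wact f w) = w; last exact: wact_len_le.
rewrite -[w](@rwK _ m) !wact_pi // -map_comp (eq_map (_ : g \o f =1 id)) ?map_id //.
Qed.

Lemma artin_mact_lift f w : Aut m f -> artin_mact f (L w) = L (wact f w).
Proof.
move=> fA; rewrite -[w](@rwK _ m) lift_reduced //; last exact: reduced_rw.
rewrite artin_mact_cls // wact_pi // lift_reduced //.
by rewrite /reduced -wact_pi // wact_len // size_map reduced_rw.
Qed.

Lemma ldesc_wact f i w : Aut m f -> ldesc (f i) (wact f w) = ldesc i w.
Proof. by move=> fA; rewrite /ldesc -wact_s // -wactM // !wact_len. Qed.

Lemma wact_longest f (J : set I) : Aut m f -> (forall i, J i -> J (f i)) ->
  spherical m J -> wact f (longest m J) = longest m J.
Proof.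
move=> fA fJ sJ; apply: longest_uniq_le => //; last by rewrite wact_len.
have /parabolicP [u Ju <-] := longest_parabolic sJ.
rewrite wact_pi //; apply/parabolicP; exists (map f u) => //.
by rewrite all_map; apply: sub_all Ju => i /= /set_mem /fJ /mem_set.
Qed.

(** * Folding *)

Section Folding.
Variable G : set (I -> I).
Hypothesis G_sub : subgroup_Aut m G.

Local Notation orbits := (spherical_orbits m G).
Local Notation r := (longest m).
Implicit Types (alpha beta : set I).

Lemma G_Aut f : G f -> Aut m f.
Proof. by case: G_sub => GA _ _ _ /GA. Qed.

Lemma orbit_stable alpha f i : orbits alpha -> G f -> alpha i -> alpha (f i).
Proof.
case: G_sub => _ _ Gcomp _ [_ [i0 ->]] Gf [g Gg <-].
by exists (f \o g) => //; exact: Gcomp.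
Qed.

Lemma orbit_trans alpha i j : orbits alpha -> alpha i -> alpha j -> exists2 f, G f & f i = j.
Proof.
case: G_sub => _ _ Gcomp Ginv [_ [i0 ->]] [f Gf <-] [g Gg <-].
have [f' [Gf' fK _]] := Ginv _ Gf.
by exists (g \o f'); [exact: Gcomp | rewrite /= fK].
Qed.

Lemma orbit_nonempty alpha : orbits alpha -> exists i, alpha i.
Proof. by case: G_sub => _ Gid _ _ [_ [i0 ->]]; exists i0, id. Qed.

Lemma orbit_spherical alpha : orbits alpha -> spherical m alpha.
Proof. by case. Qed.

Definition wfixed (w : W) := forall f, G f -> wact f w = w.

Lemma wfixed1 : wfixed 1.
Proof. by move=> f /G_Aut fA; exact: wact1. Qed.

Lemma wfixedM v w : wfixed v -> wfixed w -> wfixed (v * w).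
Proof. by move=> hv hw f Gf; rewrite wactM ?hv ?hw //; exact: G_Aut. Qed.

Lemma wfixed_longest alpha : orbits alpha -> wfixed (r alpha).
Proof.
move=> oa f Gf; apply: wact_longest; [exact: G_Aut| |exact: orbit_spherical].
by move=> i; exact: orbit_stable oa Gf.
Qed.

Lemma len_longest_gt0 alpha : orbits alpha -> (0 < len (r alpha))%N.
Proof.
move=> oa; have [i ai] := orbit_nonempty oa.
exact: leq_ltn_trans (longest_full m_coxeter (orbit_spherical oa) ai).
Qed.

(* Admissibility of the partition into orbits. *)
Lemma orbit_full_or_additive alpha w : orbits alpha -> wfixed w ->
  full alpha w \/ additive (r alpha) w.
Proof.
move=> oa fw; case: (pselect (exists2 i, alpha i & ldesc i w)) => [[i ai di]|nd].
  left=> j aj; have [f Gf <-] := orbit_trans oa ai aj.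
  by rewrite -(fw f Gf) ldesc_wact //; exact: G_Aut.
right; apply: (@ldesc_free_additive _ _ m_coxeter alpha).
  by move=> i ai; apply/negP => di; apply: nd; exists i.
exact: (longest_parabolic (orbit_spherical oa)).
Qed.

(** * Alternating products of the longest elements of two orbits *)

Definition ralt k alpha beta : W := \prod_(x <- alt k (r alpha) (r beta)) x.
Definition ralt_len k alpha beta : nat := \sum_(x <- alt k (r alpha) (r beta)) len x.
Definition ralt_reduced k alpha beta := len (ralt k alpha beta) = ralt_len k alpha beta.

Lemma raltS k alpha beta : ralt k.+1 alpha beta = r alpha * ralt k beta alpha.
Proof. exact: big_cons. Qed.

Lemma ralt_lenS k alpha beta :
  ralt_len k.+1 alpha beta = (len (r alpha) + ralt_len k beta alpha)%N.
Proof. exact: big_cons. Qed.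

Lemma ralt_le k alpha beta : (len (ralt k alpha beta) <= ralt_len k alpha beta)%N.
Proof.
elim: k alpha beta => [|k IHk] alpha beta; first by rewrite /ralt big_nil len1.
by rewrite raltS ralt_lenS (leq_trans (lenM _ _)) // leq_add2l.
Qed.

Lemma ralt_reducedS k alpha beta : ralt_reduced k.+1 alpha beta ->
  ralt_reduced k beta alpha /\ additive (r alpha) (ralt k beta alpha).
Proof.
rewrite /ralt_reduced /additive raltS ralt_lenS => E.
have le := ralt_le k beta alpha.
have := lenM (r alpha) (ralt k beta alpha); rewrite E leq_add2l => ge.
have {le ge} eq : len (ralt k beta alpha) = ralt_len k beta alpha.
  by apply/eqP; rewrite eqn_leq le.
by split=> //; rewrite eq.
Qed.

Lemma lift_ralt k alpha beta : ralt_reduced k alpha beta ->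
  L (ralt k alpha beta) = \prod_(x <- alt k (artin_longest m alpha) (artin_longest m beta)) x.
Proof.
elim: k alpha beta => [|k IHk] alpha beta; first by rewrite /ralt /= !big_nil lift1.
by move=> /ralt_reducedS [rk ad]; rewrite raltS liftM // [in RHS]/= big_cons IHk.
Qed.

Section TwoOrbits.
Variables alpha beta : set I.
Hypotheses (oa : orbits alpha) (ob : orbits beta).

Lemma ralt_fixed k : wfixed (ralt k alpha beta) /\ wfixed (ralt k beta alpha).
Proof.
elim: k => [|k [IH1 IH2]]; first by rewrite /ralt !big_nil; split; exact: wfixed1.
by rewrite !raltS; split; apply: wfixedM => //; exact: wfixed_longest.
Qed.

Lemma ralt_parabolic k : parabolic m (alpha `|` beta) (ralt k alpha beta) /\
  parabolic m (alpha `|` beta) (ralt k beta alpha).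
Proof.
elim: k => [|k [IH1 IH2]]; first by rewrite /ralt !big_nil; split; exact: parabolic1.
rewrite !raltS; split; apply: parabolicM => //.
  exact: (parabolic_sub (@subsetUl _ _ _) (longest_parabolic (orbit_spherical oa))).
exact: (parabolic_sub (@subsetUr _ _ _) (longest_parabolic (orbit_spherical ob))).
Qed.

Lemma ralt_len_ge k : (k <= ralt_len k alpha beta)%N /\ (k <= ralt_len k beta alpha)%N.
Proof.
elim: k => [|k [IH1 IH2]] //; rewrite !ralt_lenS -[k.+1]add1n.
by split; apply: leq_add => //; exact: len_longest_gt0.
Qed.

Lemma ralt_len_lt k l : (k < l)%N -> (ralt_len k alpha beta < ralt_len l alpha beta)%N.
Proof.
move=> kl; rewrite -(subnKC kl) addSnnS /ralt_len alt_cat big_cat /=.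
rewrite -[X in (X < _)%N]addn0 ltn_add2l.
case: (odd k); rewrite /= big_cons; apply: leq_trans (leq_addr _ _); exact: len_longest_gt0.
Qed.

Lemma ralt_full k : (0 < k)%N -> ralt_reduced k alpha beta -> full alpha (ralt k alpha beta).
Proof.
case: k => // k _ /ralt_reducedS [_ ad] i ai; rewrite raltS.
apply: (@ldesc_wprefix _ _ _ i (r alpha)) => //; first by exists (ralt k beta alpha).
by apply: longest_full => //; exact: orbit_spherical.
Qed.

End TwoOrbits.

(** The product is fixed, so either [r alpha] extends it additively, or all of [alpha] joins [beta]
    among its descents and it is full for the union. *)
Lemma ralt_longest_or_reduced alpha beta k : orbits alpha -> orbits beta ->
    (0 < k)%N -> ralt_reduced k beta alpha ->
  (spherical m (alpha `|` beta) /\ ralt k beta alpha = r (alpha `|` beta)) \/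
  ralt_reduced k.+1 alpha beta.
Proof.
move=> oa ob k0 red; have [_ fixk] := ralt_fixed oa ob k.
case: (orbit_full_or_additive oa fixk) => [fa|ad]; last first.
  by right; rewrite /ralt_reduced raltS ralt_lenS ad red.
left; have fK : full (alpha `|` beta) (ralt k beta alpha).
  by move=> i [/fa //|]; exact: (ralt_full ob k0 red).
split; first exact: full_spherical fK.
by apply: longest_uniq_full => //; case: (ralt_parabolic oa ob k).
Qed.

(** If the second product were not longest too, the first could be extended to a reduced product
    exceeding the longest element of the union. *)
Lemma ralt_both_longest alpha beta k : orbits alpha -> orbits beta ->
    (0 < k)%N -> ralt_reduced k beta alpha -> ralt_reduced k alpha beta ->
    ~ ralt_reduced k.+1 alpha beta ->
  [/\ spherical m (alpha `|` beta), ralt k beta alpha = r (alpha `|` beta)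
    & ralt k alpha beta = r (alpha `|` beta)].
Proof.
move=> oa ob k0 red red' nred.
have [[sK E]|//] := ralt_longest_or_reduced oa ob k0 red.
split=> //; have [[_]|redS] := ralt_longest_or_reduced ob oa k0 red'; first by rewrite setUC.
have [_ pK] := ralt_parabolic oa ob k.+1.
have := wprefix_len (full_wprefix m_coxeter (longest_full m_coxeter sK) pK).
by rewrite redS -E red leqNgt ralt_len_lt.
Qed.

(* The longest element of [alpha `|` beta] is the longest element of the
   dihedral group generated by [r alpha] and [r beta]. *)
Lemma ralt_dihedral alpha beta : orbits alpha -> orbits beta ->
    spherical m (alpha `|` beta) \/ (exists2 n, (0 < n)%N & (r alpha * r beta) ^+ n = 1) ->
  exists k, [/\ gorder (r alpha * r beta) = Some k,
    spherical m (alpha `|` beta),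
    ralt_reduced k alpha beta /\ ralt_reduced k beta alpha,
    ralt k alpha beta = r (alpha `|` beta) & ralt k beta alpha = r (alpha `|` beta)].
Proof.
move=> oa ob fin.
have sqa := longestK m_coxeter (orbit_spherical oa).
have sqb := longestK m_coxeter (orbit_spherical ob).
(* The least such [k] is where one of the two products stops being reduced; it is at least [2], and
   the order sought is one less. *)
pose P k := `[< ~ (ralt_reduced k alpha beta /\ ralt_reduced k beta alpha) >].
(* Lengths are bounded in the spherical case; otherwise the product of [n.*2] factors is [1]. *)
have exP : exists k, P k.
  case: fin => [sK|[n n0 abn]].
    exists (len (r (alpha `|` beta))).+1; apply/asboolP => -[red _].
    have [pK _] := ralt_parabolic oa ob (len (r (alpha `|` beta))).+1.
    have := wprefix_len (full_wprefix m_coxeter (longest_full m_coxeter sK) pK).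
    rewrite red leqNgt => /negP; apply.
    by case: (ralt_len_ge oa ob (len (r (alpha `|` beta))).+1).
  exists n.*2; apply/asboolP => -[+ _]; rewrite /ralt_reduced /ralt prod_alt_double abn len1.
  have [+ _] := ralt_len_ge oa ob n.*2 => /[swap] <-.
  by rewrite leqn0 double_eq0 => /eqP n00; rewrite n00 in n0.
case: (ex_minnP exP) => -[|[|k]] /asboolP Pk kmin.
- by case: Pk; split; rewrite /ralt_reduced /ralt /ralt_len !big_nil len1.
- by case: Pk; split; rewrite /ralt_reduced /ralt /ralt_len !big_cons !big_nil mulg1 addn0.
have red l : (l < k.+2)%N -> ralt_reduced l alpha beta /\ ralt_reduced l beta alpha.
  by move=> lk; apply: contrapT => /asboolP /kmin; rewrite leqNgt lk.
have [red1 red2] := red k.+1 (ltnSn _).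
have [sK E1 E2] : [/\ spherical m (alpha `|` beta),
    ralt k.+1 alpha beta = r (alpha `|` beta) & ralt k.+1 beta alpha = r (alpha `|` beta)].
  case: (pselect (ralt_reduced k.+2 alpha beta)) => [red3|nred].
    have nred : ~ ralt_reduced k.+2 beta alpha by move=> red4; case: Pk.
    by have [] := ralt_both_longest ob oa (ltn0Sn k) red1 red2 nred; rewrite setUC.
  by have [] := ralt_both_longest oa ob (ltn0Sn k) red2 red1 nred.
exists k.+1; split=> //; apply: gorderP => //.
  by apply/prod_altC => //; rewrite -/(ralt _ _ _) E1.
(* Equal products with fewer factors would be full for both orbits, hence longest, yet strictly
   shorter. *)
move=> n n0 /prod_altC -/(_ sqa sqb); rewrite -/(ralt n alpha beta) -/(ralt n beta alpha) => E.
rewrite leqNgt; apply/negP => nk.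
have [redn redn'] := red n (ltnW nk).
have En : ralt n alpha beta = r (alpha `|` beta).
  apply: longest_uniq_full => //; first by case: (ralt_parabolic oa ob n).
  by move=> i []; [|rewrite E]; exact: ralt_full.
have := ralt_len_lt oa ob nk.
by rewrite -redn -red1 En E1 ltnn.
Qed.

Local Notation m' := (folded_matrix m G).

(** A label [1] means equal longest elements, and an orbit is the set of left descents of its
    longest element. *)
Lemma folded_coxeter : coxeter_matrix m'.
Proof.
have om (a : set_type orbits) : orbits (val a) by case: a => a /= /set_mem.
have sq a := longestK m_coxeter (orbit_spherical (om a)).
have Vr a := longestV m_coxeter (orbit_spherical (om a)).
split=> [a b|a b|a b].
- by rewrite /folded_matrix -gorderV invgM !Vr.
- by rewrite /folded_matrix => /gorder_Some [].
split=> [/gorder_Some [_]|->]; last first.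
  by rewrite /folded_matrix; apply: gorderP; rewrite // expg1 sq.
rewrite expg1 => /mulg1_eq; rewrite Vr => E.
have sub (c d : set_type orbits) : r (val c) = r (val d) -> val c `<=` val d.
  move=> Ecd i ci; apply: (@parabolic_ldesc _ i (r (val d))).
    exact: (longest_parabolic (orbit_spherical (om d))).
  by rewrite -Ecd; apply: longest_full => //; exact: orbit_spherical (om c).
by apply: val_inj; apply/seteqP; split; apply: sub.
Qed.

End Folding.
End DiagramAction.

(** * Isomorphisms of pairs and group homomorphisms *)

Lemma pair_iso_inverse (M N : monoidType) (Phi : N -> M) (T : set N) :
    {morph Phi : x y / x * y} -> Phi 1 = 1 -> injective Phi ->
  pair_iso (range Phi) (Phi @` T) setT T.
Proof.
move=> PhiM Phi1 Phi_inj.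
(* The inverse of [Phi] on its range, with default value [1] elsewhere. *)
pose f b := xget (1 : N) [set x | Phi x = b].
have fK : cancel Phi f.
  move=> x; apply: Phi_inj.
  by apply: (@xgetPex _ 1 [set y | Phi y = Phi x]); exists x.
exists f; split.
- split=> // [_ _ /set_mem [x _ <-] /set_mem [y _ <-]|x _]; first by rewrite !fK => ->.
  by exists (Phi x); [exists x | rewrite fK].
- by rewrite -Phi1 fK.
- by move=> _ _ [x _ <-] [y _ <-]; rewrite -PhiM !fK.
apply/seteqP; split=> [_ [_ [x Tx <-] <-]|x Tx]; first by rewrite fK.
by exists (Phi x); [exists x | rewrite fK].
Qed.

Section GroupHom.
Variables (H K : groupType) (f : H -> K).
Hypothesis fM : {morph f : x y / x * y}.

Lemma ghom1 : f 1 = 1.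
Proof. by apply: (@mulgI _ (f 1)); rewrite -fM !mulg1. Qed.

Lemma ghomV x : f x^-1 = (f x)^-1.
Proof. by apply/esym/mulg1_eq; rewrite -fM mulgV ghom1. Qed.

Lemma ghomX x n : f (x ^+ n) = f x ^+ n.
Proof. by elim: n => [|n IHn]; rewrite ?ghom1 // !expgS fM IHn. Qed.

End GroupHom.

Lemma gextend_gen (X : Type) (R : seq X -> seq X -> Prop) (H : groupType) (phi : X -> H) x :
    (forall v w, R v w -> \prod_(y <- v) phi y = \prod_(y <- w) phi y) ->
  gextend phi (ggen R x) = phi x.
Proof.
move=> phiR; rewrite /gextend [LHS](@pextend_class _ _ _ _ [:: (x, true)]).
  by rewrite big_cons big_nil mulg1.
exact: (gextend_rel phiR).
Qed.

(* The group of fractions of a presented monoid: if some central cancellable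
   [z] is a multiple of every generator, inverting [z] inverts everything. *)
Section Fractions.
Variables (X : Type) (R : seq X -> seq X -> Prop).

Local Notation M := (pmonoid R).
Local Notation Gp := (pgroup R).
Local Notation gen := (pgen R).
Local Notation cls := (pclass R).
Local Notation incl := (pextend (ggen R) : M -> Gp).

Lemma gclass_letter x (e : bool) :
  pclass (group_rel R) [:: (x, e)] = (if e then ggen R x else (ggen R x)^-1) :> Gp.
Proof.
case: e => //; apply/esym/mulg1_eq; rewrite [LHS]pmulE; apply/pclassP.
exact: (@CongRel _ _ [::] [::] _ _ (GroupCancel R x true)).
Qed.

Lemma ggen_rel u v : R u v -> \prod_(x <- u) ggen R x = \prod_(x <- v) ggen R x.
Proof.
move=> uv; rewrite !prod_ggen; apply/pclassP.
by have := @CongRel _ _ [::] [::] _ _ (GroupRel uv); rewrite /= !cats0.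
Qed.

Lemma inclM : {morph incl : x y / x * y}.
Proof. by move=> x y; apply: pextendM => v w; exact: ggen_rel. Qed.

Lemma incl_cls u : incl (cls u) = \prod_(x <- u) ggen R x.
Proof. by apply: pextend_class => v w; exact: ggen_rel. Qed.

Lemma incl1 : incl 1 = 1.
Proof. by rewrite [LHS](incl_cls [::]) big_nil. Qed.

Lemma inclX b n : incl (b ^+ n) = incl b ^+ n.
Proof. by elim: n => [|n IHn]; rewrite ?incl1 // !expgS inclM IHn. Qed.

Lemma incl_gen x : incl (gen x) = ggen R x.
Proof. by rewrite [LHS](incl_cls [:: x]) big_cons big_nil mulg1. Qed.

Variables (z : M) (d : X -> M).
Hypotheses (gen_d : forall x, gen x * d x = z) (d_gen : forall x, d x * gen x = z).
Hypothesis gen_z : forall x, gen x * z = z * gen x.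
Hypothesis z_cancel : forall a b : M, a * z = b * z -> a = b.

Lemma z_central (b : M) : b * z = z * b.
Proof.
rewrite -[b]pwordK -prod_pgen; elim: (pword b) => [|x u IHu].
  by rewrite big_nil mulg1 mul1g.
by rewrite big_cons -mulgA IHu !mulgA gen_z.
Qed.

Lemma zX_central (b : M) n : b * z ^+ n = z ^+ n * b.
Proof. exact: (commuteX _ (z_central b)). Qed.

Lemma zX_cancel (a b : M) n : a * z ^+ n = b * z ^+ n -> a = b.
Proof. by elim: n => [|n IHn]; rewrite ?mulg1 // expgSr !mulgA => /z_cancel. Qed.

(** A negative letter is read as [d x] over [z], so that [w] stands for the fraction
    [numerator w / z ^ denominator w]. *)
Definition numerator (w : seq (X * bool)) : M :=
  \prod_(x <- w) (if x.2 then gen x.1 else d x.1).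

Definition denominator (w : seq (X * bool)) : nat := count (fun x => ~~ x.2) w.

Lemma numerator_cat u v : numerator (u ++ v) = numerator u * numerator v.
Proof. exact: big_cat. Qed.

Lemma denominator_cat u v : denominator (u ++ v) = (denominator u + denominator v)%N.
Proof. exact: count_cat. Qed.

Lemma numerator_positive u : numerator [seq (x, true) | x <- u] = cls u.
Proof. by rewrite /numerator big_map prod_pgen. Qed.

Lemma denominator_positive u : denominator [seq (x, true) | x <- u] = 0%N.
Proof. by elim: u. Qed.

(** Equality of fractions, cross-multiplied; transitivity cancels a power of [z]. *)
Lemma numerator_cong w w' : cong (group_rel R) w w' ->
  numerator w * z ^+ denominator w' = numerator w' * z ^+ denominator w.
Proof.
elim=> {w w'} [a b u v uv|//|//|u v w _ IH1 _ IH2]; last first.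
  apply: (@zX_cancel _ _ (denominator v)).
  rewrite -mulgA -expgnDr addnC expgnDr mulgA IH1 -mulgA -expgnDr addnC expgnDr mulgA IH2.
  by rewrite -!mulgA -!expgnDr addnC.
have {uv} loc : numerator u * z ^+ denominator v = numerator v * z ^+ denominator u.
  case: uv => [u' v' uv|x e].
    rewrite !numerator_positive !denominator_positive !mulg1; apply/pclassP.
    by have := @CongRel _ _ [::] [::] _ _ uv; rewrite /= !cats0.
  rewrite /numerator /denominator !big_cons big_nil /= mul1g !mulg1.
  by case: e; rewrite /= ?gen_d ?d_gen.
rewrite !numerator_cat !denominator_cat.
have shift (p q t : M) k l n :
    p * (q * t) * z ^+ (k + (l + n)) = p * (q * z ^+ l) * t * z ^+ (k + n).
  by rewrite addnCA expgnDr !mulgA -(mulgA (p * q)) (zX_central t) !mulgA.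
by rewrite !shift loc.
Qed.

Lemma incl_inj : injective incl.
Proof.
move=> a b; rewrite -[a]pwordK -[b]pwordK !incl_cls !prod_ggen => /pclassP /numerator_cong.
by rewrite !numerator_positive !denominator_positive !mulg1.
Qed.

(** Each inverse letter is absorbed by one more central factor [z], leaving [d x]. *)
Lemma fraction (g : Gp) : exists b k, incl b = g * incl z ^+ k.
Proof.
rewrite -[g]pwordK; elim: (pword g) => [|[x e] w [b [k E]]].
  by exists 1, 0%N; rewrite incl1 mulg1.
rewrite -cat1s [pclass _ _](pclass_cat (group_rel R)) gclass_letter; case: e.
  by exists (gen x * b), k; rewrite inclM E incl_gen mulgA.
exists (d x * b), k.+1; rewrite expgSr -!mulgA (mulgA (pclass _ w)) -E.
rewrite -inclM z_central !inclM mulgA; congr (_ * _).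
by rewrite -(gen_d x) inclM incl_gen mulKg.
Qed.

End Fractions.

(** * The homomorphism from the positive monoid of the folded type *)

Section FoldedSystem.
Variables (I : Type) (m : cmatrix I) (G : set (I -> I)).
Hypotheses (m_coxeter : coxeter_matrix m) (G_sub : subgroup_Aut m G).

Local Notation L := (@artin_lift I m).
Local Notation B := (artin_monoid m).
Local Notation gen := (artin_mgen m).
Local Notation orbits := (spherical_orbits m G).
Local Notation m' := (folded_matrix m G).
Local Notation r := (longest m).
Local Notation rl := (artin_longest m).
Implicit Types a b c : set_type orbits.

Lemma orbit_val a : orbits (val a).
Proof. by case: a => a /= /set_mem. Qed.

(** By [ralt_dihedral] both sides are reduced products lifting the longest element of the union. *)
Lemma fold_braid u v : braid_rel m' u v ->
  \prod_(a <- u) rl (val a) = \prod_(a <- v) rl (val a).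
Proof.
move=> [a b n abn]; have oa := orbit_val a; have ob := orbit_val b.
have [k [E sK [red1 red2] E1 E2]] : exists k, [/\ gorder (r (val a) * r (val b)) = Some k,
    spherical m (val a `|` val b),
    ralt_reduced m k (val a) (val b) /\ ralt_reduced m k (val b) (val a),
    ralt m k (val a) (val b) = r (val a `|` val b)
    & ralt m k (val b) (val a) = r (val a `|` val b)].
  apply: (ralt_dihedral m_coxeter G_sub oa ob).
  by right; have [n0 En] := gorder_Some abn; exists n.
have {E} nk : n = k by move: abn; rewrite /folded_matrix E => -[].
rewrite -(big_map (fun a : set_type orbits => rl (val a)) xpredT id).
rewrite -[RHS](big_map (fun a : set_type orbits => rl (val a)) xpredT id).
rewrite !alt_map nk.
by rewrite -!(lift_ralt m_coxeter) // E1 E2.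
Qed.

Definition fold : artin_monoid m' -> B := pextend (fun a => rl (val a)).

Lemma foldM : {morph fold : x y / x * y}.
Proof. by move=> x y; apply: pextendM; exact: fold_braid. Qed.

Lemma fold_cls u : fold (pclass (braid_rel m') u) = \prod_(a <- u) rl (val a).
Proof. by apply: pextend_class; exact: fold_braid. Qed.

Lemma fold1 : fold 1 = 1.
Proof. by rewrite [LHS](fold_cls [::]) big_nil. Qed.

Lemma fold_gen a : fold (artin_mgen m' a) = rl (val a).
Proof. by rewrite [LHS](fold_cls [:: a]) big_cons big_nil mulg1. Qed.

Lemma gen_mdiv_longest a i : val a i -> mdiv (gen i) (rl (val a)).
Proof.
move=> ai; have sa := orbit_spherical (orbit_val a).
have /wprefix_sP [//|w wE iw] := longest_full m_coxeter sa ai.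
by exists (L w); rewrite /artin_longest wE liftM // lift_s.
Qed.

(* [fold] respects the least common multiples of generators, hence reflects
   divisibility by generators. *)
Lemma fold_reflects_mdiv n a (x : artin_monoid m') : (bsize x <= n)%N ->
  mdiv (rl (val a)) (fold x) -> mdiv (artin_mgen m' a) x.
Proof.
elim: n a x => [|n IHn] a x le ax.
  have xE : x = 1.
    by case: (cls_case x) le => [->//|[b [y ->]]]; rewrite bsizeM bsize_gen.
  move: ax; rewrite xE fold1 => -[y /(congr1 (@bsize _ _))].
  rewrite bsize1 bsizeM bsize_lift // => /esym/eqP; rewrite addn_eq0 => /andP [].
  by rewrite eqn0Ngt (len_longest_gt0 m_coxeter G_sub (orbit_val a)).
(* Extends the induction hypothesis from generators to words, cancelling the image of one generator
   at a time. *)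
have words u (y : artin_monoid m') : (bsize y <= n)%N ->
    mdiv (fold (pclass (braid_rel m') u)) (fold y) -> mdiv (pclass (braid_rel m') u) y.
  elim: u y => [|c u IHu] y ley; first by exists y; rewrite mul1g.
  rewrite cls_cons foldM fold_gen => cy.
  have [y' yE] := IHn _ _ ley (mdivMr cy); rewrite yE.
  have [||w ->] := IHu y'; last by exists w; rewrite mulgA.
    by apply: leq_trans ley; rewrite yE bsizeM leq_addl.
  move: cy; rewrite yE foldM fold_gen => -[w].
  by rewrite -mulgA => /(artin_mulIgl m_coxeter) ->; exists w.
case: (cls_case x) => [x1|[b [y xE]]].
  by apply: IHn ax; rewrite x1 bsize1.
move: le ax; rewrite xE bsizeM bsize_gen ltnS foldM fold_gen => le ax.
have oa := orbit_val a; have ob := orbit_val b.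
have [|sK [c cE]] := @mdiv_longest _ _ m_coxeter (val b `|` val a) (rl (val b) * fold y).
  move=> i [bi|ai]; last exact: mdiv_trans (gen_mdiv_longest ai) ax.
  apply: mdiv_trans (gen_mdiv_longest bi) _; by exists (fold y).
have [k [E _ [red1 red2] E1 E2]] := ralt_dihedral m_coxeter G_sub ob oa (or_introl sK).
have altE : pclass (braid_rel m') (alt k b a) = pclass (braid_rel m') (alt k a b).
  apply/pclassP; have := @CongRel _ _ [::] [::] _ _ (@BraidRel _ m' b a k E).
  by rewrite /= !cats0.
have foldK : fold (pclass (braid_rel m') (alt k b a)) = rl (val b `|` val a).
  rewrite fold_cls -(big_map (fun a : set_type orbits => rl (val a)) xpredT id).
  by rewrite alt_map -(lift_ralt m_coxeter) // E1.
case: k E altE foldK {red1 red2 E1 E2} => [|k] E altE foldK; first by case: (gorder_Some E).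
(* The longest element of the union, image of [alt k.+1 b a], divides [fold x]; cancelling its first
   factor leaves a divisibility in [fold y], with [y] shorter than [x]. *)
rewrite -foldK /= cls_cons foldM fold_gen -mulgA in cE.
have {}cE := artin_mulIgl m_coxeter cE.
have [|w ->] := words (alt k a b) y le; first by exists c.
rewrite mulgA -cls_cons -[b :: _]/(alt k.+1 b a) altE /= cls_cons -mulgA.
by exists (pclass (braid_rel m') (alt k b a) * w).
Qed.

(** The first generator of [x] divides [y] by [fold_reflects_mdiv]; cancel its image and induct. *)
Lemma fold_inj : injective fold.
Proof.
move=> x; elim/cls_ind: x => [|a x IHx] y.
  case: (cls_case y) => [->//|[b [z ->]]].
  rewrite fold1 foldM fold_gen => /(congr1 (@bsize _ _)).
  rewrite bsize1 bsizeM bsize_lift // => /esym/eqP; rewrite addn_eq0 => /andP [].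
  by rewrite eqn0Ngt (len_longest_gt0 m_coxeter G_sub (orbit_val b)).
rewrite foldM fold_gen => E.
have [|z yE] := @fold_reflects_mdiv _ a y (leqnn _); first by rewrite -E; exists (fold x).
rewrite yE in E *; congr (_ * _); apply: IHx.
by move: E; rewrite foldM fold_gen; exact: artin_mulIgl.
Qed.

Lemma artin_mact1 f : Aut m f -> artin_mact f (1 : B) = 1.
Proof. by move=> fA; exact: (artin_mact_cls [::] fA). Qed.

Lemma artin_mact_gen f i : Aut m f -> artin_mact f (gen i) = gen (f i).
Proof. by move=> fA; exact: (artin_mact_cls [:: i] fA). Qed.

Lemma rl_fixed a : artin_mfixed m G (rl (val a)).
Proof.
move=> f Gf; have fA := G_Aut G_sub Gf.
by rewrite artin_mact_lift // (wfixed_longest m_coxeter G_sub (orbit_val a)).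
Qed.

Lemma mfixed_submonoid : submonoid (artin_mfixed m G).
Proof.
split=> [f|x y fx fy f] Gf; first by apply: artin_mact1; exact: G_Aut Gf.
by rewrite artin_mactM ?fx ?fy //; exact: G_Aut Gf.
Qed.

Lemma mfixed_complement (x y : B) :
  artin_mfixed m G x -> artin_mfixed m G (x * y) -> artin_mfixed m G y.
Proof.
move=> fx fxy f Gf; have := fxy f Gf.
by rewrite (artin_mactM (G_Aut G_sub Gf)) fx // => /(artin_mulIgl m_coxeter).
Qed.

(** Invariance spreads the first letter of [x] over its orbit; [mdiv_longest] makes the orbit
    spherical and extracts its longest element, leaving a shorter fixed factor. *)
Lemma mfixed_fold (x : B) : artin_mfixed m G x -> exists y, x = fold y.
Proof.
move: {2}(bsize x) (leqnn (bsize x)) => n; elim: n x => [|n IHn] x le fx.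
  exists 1; rewrite fold1.
  by case: (cls_case x) le => [->//|[b [y ->]]]; rewrite bsizeM bsize_gen.
case: (cls_case x) => [->|[i [y xE]]]; first by exists 1; rewrite fold1.
pose alpha := [set f i | f in G].
have [|sa [c cE]] := @mdiv_longest _ _ m_coxeter alpha x.
  move=> _ [f Gf <-]; have fA := G_Aut G_sub Gf.
  by rewrite -(fx f Gf) xE (artin_mactM fA) artin_mact_gen //; exists (artin_mact f y).
have oa : orbits alpha by split=> //; exists i.
pose a : set_type orbits := SigSub (mem_set oa).
have ax : artin_mfixed m G (rl alpha) := @rl_fixed a.
have lec : (bsize c <= n)%N.
  rewrite -ltnS; apply: leq_trans le; rewrite cE bsizeM bsize_lift // -add1n leq_add2r.
  exact: (len_longest_gt0 m_coxeter G_sub oa).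
have fc : artin_mfixed m G c by apply: (mfixed_complement ax); rewrite -cE.
have [z zE] := IHn c lec fc.
by exists (artin_mgen m' a * z); rewrite foldM fold_gen -zE.
Qed.

Lemma fold_image_gens : fold @` range (artin_mgen m') = folded_gens m G.
Proof.
apply/seteqP; split=> [_ [_ [a _ <-] <-]|_ [alpha oa <-]].
  by rewrite fold_gen; exists (val a) => //; exact: orbit_val.
exists (artin_mgen m' (SigSub (mem_set oa))); first by eexists.
by rewrite fold_gen.
Qed.

Lemma fold_gen_monoid y : gen_monoid (folded_gens m G) (fold y).
Proof.
move=> A [[A1 AM] SA]; elim/cls_ind: y => [|a y IHy]; first by rewrite fold1.
rewrite foldM fold_gen; apply: AM => //; apply: SA.
by exists (val a) => //; exact: orbit_val.
Qed.

Lemma range_fold : range fold = artin_mfixed m G.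
Proof.
apply/seteqP; split=> [_ [y _ <-]|x /mfixed_fold [y ->]]; last by exists y.
apply: fold_gen_monoid; split; first exact: mfixed_submonoid.
by move=> _ [alpha oa <-]; exact: (@rl_fixed (SigSub (mem_set oa))).
Qed.

Lemma mfixed_gen_monoid : artin_mfixed m G = gen_monoid (folded_gens m G).
Proof.
apply/seteqP; split=> [x|x]; first by rewrite -range_fold => -[y _ <-]; exact: fold_gen_monoid.
apply; split; first exact: mfixed_submonoid.
by move=> _ [alpha oa <-]; exact: (@rl_fixed (SigSub (mem_set oa))).
Qed.

End FoldedSystem.

(** * Spherical type *)

Section SphericalType.
Variables (I : Type) (m : cmatrix I).
Hypotheses (m_coxeter : coxeter_matrix m) (I_spherical : spherical m [set: I]).

Local Notation s := (s_ m).
Local Notation L := (@artin_lift I m).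
Local Notation len := (@length I m).
Local Notation B := (artin_monoid m).
Local Notation gen := (artin_mgen m).
Local Notation r := (longest m [set: I]).

Definition garside : B := artin_longest m [set: I].
(** The complement of a generator in the square of [garside], used because [garside] itself may
    permute the generators. *)
Definition garside_compl i : B := L (s i * r) * garside.

Lemma parabolicT w : parabolic m [set: I] w.
Proof.
apply/parabolicP; exists (reduced_word w); last exact: rwK.
by elim: (reduced_word w) => //= i u ->; rewrite in_setT.
Qed.

(** The element [s i * r] is a prefix of [r] one letter short; that letter is [j]. *)
Lemma garside_conj i : exists2 j, s i * r = r * s j & s j * r = r * s i.
Proof.
have rr := longestK m_coxeter I_spherical.
have [x rE ix] :=
  full_wprefix m_coxeter (longest_full m_coxeter I_spherical) (parabolicT (s i * r)).
have len_x : len x = 1%N.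
  have := ldescP m_coxeter (longest_full m_coxeter I_spherical (i := i) Logic.I).
  by rewrite [in LHS]rE ix -addn1 => /addnI.
have [[|j [|k u]] [_ uE]] := parabolic_reduced m_coxeter (parabolicT x);
  rewrite /reduced uE len_x //.
move: uE; rewrite big_cons big_nil mulg1 => jx _.
have irj : s i * r * s j = r by rewrite jx -rE.
have sri : s i * r = r * s j by rewrite -{2}irj sgK.
exists j => //; apply: (@mulgI _ r); rewrite mulgA -sri -mulgA rr mulg1.
by rewrite mulgA rr mul1g.
Qed.

Lemma gen_lift_garside i : gen i * L (s i * r) = garside.
Proof.
rewrite -lift_s // -liftM ?sKg //; apply: additive_s => //.
by rewrite /ldesc sKg -leqNgt ltnW //; exact: longest_full.
Qed.

Lemma garside_swap i j : s i * r = r * s j -> gen i * garside = garside * gen j.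
Proof.
move=> E; have {1}-> : garside = L (r * s j) * gen j.
  rewrite -lift_s // -liftM ?sgK //; apply: additive_sr => //.
  rewrite /rdesc sgK -leqNgt ltnW // -E; exact: longest_full.
by rewrite -E mulgA gen_lift_garside.
Qed.

Lemma gen_garside2 i : gen i * (garside * garside) = garside * garside * gen i.
Proof.
have [j E1 E2] := garside_conj i.
by rewrite mulgA (garside_swap E1) -mulgA (garside_swap E2) mulgA.
Qed.

Lemma gen_garside_compl i : gen i * garside_compl i = garside * garside.
Proof. by rewrite mulgA gen_lift_garside. Qed.

Lemma garside_compl_gen i : garside_compl i * gen i = garside * garside.
Proof.
apply: (@artin_mulIgl _ _ m_coxeter (gen i)).
by rewrite mulgA gen_garside_compl gen_garside2.
Qed.

Lemma garside2_central (b : B) : b * (garside * garside) = garside * garside * b.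
Proof. exact: (z_central gen_garside2). Qed.

Lemma garside2_cancel (a b : B) : a * (garside * garside) = b * (garside * garside) -> a = b.
Proof. by rewrite !garside2_central => /(artin_mulIgl m_coxeter). Qed.

Lemma artin_incl_inj : injective (artin_incl m).
Proof.
exact: (incl_inj gen_garside_compl garside_compl_gen gen_garside2 garside2_cancel).
Qed.

Lemma artin_fraction (g : artin_group m) :
  exists b k, artin_incl m b = g * artin_incl m (garside * garside) ^+ k.
Proof. exact: (fraction gen_garside_compl gen_garside2). Qed.

(** * Fixed elements of the Artin-Tits group *)

Section Fold.
Variable G : set (I -> I).
Hypothesis G_sub : subgroup_Aut m G.

Local Notation orbits := (spherical_orbits m G).
Local Notation m' := (folded_matrix m G).
Local Notation rl := (artin_longest m).
Local Notation incl := (artin_incl m).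
Local Notation fold := (@fold I m G).

Let foldM : {morph fold : x y / x * y} := foldM m_coxeter G_sub.
Let fold_inj : injective fold := @fold_inj I m G m_coxeter G_sub.
Let fold_gen a : fold (artin_mgen m' a) = rl (val a) := fold_gen m_coxeter G_sub a.
Let inclM : {morph incl : x y / x * y} := @artin_inclM I m.

Lemma garside2_fixed : artin_mfixed m G (garside * garside).
Proof.
have Df : artin_mfixed m G garside.
  move=> f Gf; have fA := G_Aut G_sub Gf.
  by rewrite artin_mact_lift // wact_longest.
by case: (mfixed_submonoid G_sub) => _; apply.
Qed.

Lemma fold_mulIgl (a x y : artin_monoid m') : a * x = a * y -> x = y.
Proof.
by move=> /(congr1 fold); rewrite !foldM => /(artin_mulIgl m_coxeter) /fold_inj.
Qed.

(** Squared [garside] is fixed, so it comes from the folded monoid, and so do its quotients by the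
    [rl (val a)]; its properties pull back along the injective [fold]. *)
Lemma folded_garside : exists z' : artin_monoid m', exists d : set_type orbits -> artin_monoid m',
  [/\ fold z' = garside * garside, forall a, artin_mgen m' a * d a = z',
      forall a, d a * artin_mgen m' a = z', forall x, x * z' = z' * x
    & forall x y, x * z' = y * z' -> x = y].
Proof.
have [z' zE] := mfixed_fold m_coxeter G_sub garside2_fixed.
have z'C x : x * z' = z' * x.
  by apply: fold_inj; rewrite !foldM -zE garside2_central.
have dP a : exists d, artin_mgen m' a * d = z'.
  have [|_ [c cE]] := @mdiv_longest _ _ m_coxeter (val a) (garside * garside).
    by move=> i _; exists (garside_compl i); rewrite gen_garside_compl.
  have fc : artin_mfixed m G c.
    apply: (mfixed_complement m_coxeter G_sub (@rl_fixed _ _ _ m_coxeter G_sub a)).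
    by rewrite -cE; exact: garside2_fixed.
  have [d dE] := mfixed_fold m_coxeter G_sub fc.
  by exists d; apply: fold_inj; rewrite foldM fold_gen -dE -cE zE.
have [d dE] := choice dP; exists z', d; split=> // [a|x y].
  by apply: (@fold_mulIgl (artin_mgen m' a)); rewrite mulgA dE -z'C.
by rewrite !z'C; exact: fold_mulIgl.
Qed.

Definition gfold : artin_group m' -> artin_group m := gextend (fun a => incl (rl (val a))).

Lemma gfold_rel u v : braid_rel m' u v ->
  \prod_(a <- u) incl (rl (val a)) = \prod_(a <- v) incl (rl (val a)).
Proof.
have prodE w : \prod_(a <- w) incl (rl (val a)) = incl (\prod_(a <- w) rl (val a)).
  elim: w => [|a w IHw]; first by rewrite !big_nil; exact/esym/incl1.
  by rewrite !big_cons inclM IHw.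
by move=> uv; rewrite !prodE (fold_braid m_coxeter G_sub uv).
Qed.

Lemma gfoldM : {morph gfold : x y / x * y}.
Proof. by move=> x y; apply: gextendM; exact: gfold_rel. Qed.

Lemma gfold_gen a : gfold (artin_gen m' a) = incl (rl (val a)).
Proof. by apply: gextend_gen; exact: gfold_rel. Qed.

Lemma gfold_incl b : gfold (artin_incl m' b) = incl (fold b).
Proof.
elim/cls_ind: b => [|a b IHb].
  by rewrite [artin_incl m' 1]incl1 (ghom1 gfoldM) (fold1 m_coxeter G_sub) [RHS]incl1.
rewrite artin_inclM gfoldM IHb foldM inclM fold_gen; congr (_ * _).
by rewrite [artin_incl m' _]incl_gen [LHS]gfold_gen.
Qed.

(** Over a common denominator, equality of images reduces to injectivity of [incl] and [fold]. *)
Lemma gfold_inj : injective gfold.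
Proof.
have [z' [d [zE gen_d d_gen zC z_can]]] := folded_garside.
have gen_z a := zC (artin_mgen m' a).
move=> g h E.
have [b [k bE]] := fraction gen_d gen_z g.
have [c [l cE]] := fraction gen_d gen_z h.
rewrite -!/(artin_incl m' _) in bE cE.
pose Z := artin_incl m' z'.
have bl : artin_incl m' (b * z' ^+ l) = g * Z ^+ (k + l).
  by rewrite artin_inclM bE expgnDr mulgA; congr (_ * _); exact: inclX.
have ck : artin_incl m' (c * z' ^+ k) = h * Z ^+ (k + l).
  by rewrite artin_inclM cE addnC expgnDr mulgA; congr (_ * _); exact: inclX.
have : gfold (artin_incl m' (b * z' ^+ l)) = gfold (artin_incl m' (c * z' ^+ k)).
  by rewrite bl ck !gfoldM E.
rewrite !gfold_incl => /artin_incl_inj /fold_inj bc.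
by move: bl; rewrite bc ck => /mulIg.
Qed.

Lemma artin_gact_incl f b : Aut m f -> artin_gact f (incl b) = incl (artin_mact f b).
Proof.
move=> fA; have fM := artin_gactM fA.
elim/cls_ind: b => [|i b IHb].
  by rewrite [incl 1]incl1 (ghom1 fM) artin_mact1 // [RHS]incl1.
rewrite inclM fM IHb artin_mactM // inclM artin_mact_gen // [incl (gen i)]incl_gen.
rewrite [incl (gen (f i))]incl_gen; congr (_ * _).
apply: gextend_gen => _ _ [j k n mjk].
rewrite -!(big_map f xpredT (@artin_gen _ m)) !alt_map.
by apply: ggen_rel; apply: BraidRel; case: fA => _ ->.
Qed.

Lemma gfixed_subgroup : subgroup (artin_gfixed m G).
Proof.
split; first split.
- by move=> f /(G_Aut G_sub) fA; exact: (ghom1 (artin_gactM fA)).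
- by move=> x y fx fy f Gf; rewrite (artin_gactM (G_Aut G_sub Gf)) fx ?fy.
- by move=> x fx f Gf; rewrite (ghomV (artin_gactM (G_Aut G_sub Gf))) fx.
Qed.

(** Multiplying by a power of the fixed element [garside * garside] moves [g] into the monoid
    without losing invariance. *)
Lemma gfixed_gfold g : artin_gfixed m G g -> exists h, g = gfold h.
Proof.
move=> fg; have [b [k bE]] := artin_fraction g.
have fb : artin_mfixed m G b.
  move=> f Gf; have fA := G_Aut G_sub Gf; apply: artin_incl_inj.
  rewrite -artin_gact_incl // bE (artin_gactM fA) (ghomX (artin_gactM fA)).
  by rewrite artin_gact_incl // garside2_fixed // fg.
have [b' b'E] := mfixed_fold m_coxeter G_sub fb.
have [z' z'E] := mfixed_fold m_coxeter G_sub garside2_fixed.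
exists (artin_incl m' b' * (artin_incl m' z' ^+ k)^-1).
rewrite gfoldM (ghomV gfoldM) (ghomX gfoldM) !gfold_incl -b'E -z'E bE.
by rewrite mulgK.
Qed.

Local Notation gens := (incl @` folded_gens m G).

Lemma gfold_gen_group h : gen_group gens (gfold h).
Proof.
move=> A [[[A1 AM] AV] SA].
rewrite -[h]pwordK; elim: (pword h) => [|[a e] w IHw].
  by rewrite [gfold _](ghom1 gfoldM).
rewrite -cat1s [pclass _ _]pclass_cat gclass_letter gfoldM; apply: AM => //.
have Aa : A (incl (rl (val a))).
  by apply: SA; exists (rl (val a)) => //; exists (val a) => //; exact: orbit_val.
by case: e; rewrite ?(ghomV gfoldM) [gfold _]gfold_gen //; exact: AV.
Qed.

Lemma gen_group_gfixed : gen_group gens `<=` artin_gfixed m G.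
Proof.
move=> g; apply; split; first exact: gfixed_subgroup.
move=> _ [_ [alpha oa <-] <-] f Gf; rewrite artin_gact_incl; last exact: G_Aut Gf.
by rewrite (@rl_fixed _ _ _ m_coxeter G_sub (SigSub (mem_set oa))).
Qed.

Lemma range_gfold : range gfold = artin_gfixed m G.
Proof.
apply/seteqP; split=> [_ [h _ <-]|g /gfixed_gfold [h ->]]; last by exists h.
by apply: gen_group_gfixed; exact: gfold_gen_group.
Qed.

Lemma gfixed_gen_group : artin_gfixed m G = gen_group gens.
Proof.
apply/seteqP; split=> [g|]; last exact: gen_group_gfixed.
by rewrite -range_gfold => -[h _ <-]; exact: gfold_gen_group.
Qed.

Lemma gfold_image_gens : gfold @` range (artin_gen m') = gens.
Proof.
rewrite -(fold_image_gens m_coxeter G_sub); apply/seteqP; split.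
  move=> _ [_ [a _ <-] <-]; exists (fold (artin_mgen m' a)); last by rewrite gfold_gen fold_gen.
  by exists (artin_mgen m' a) => //; exists a.
move=> _ [_ [_ [a _ <-] <-] <-]; exists (artin_gen m' a); first by exists a.
by rewrite gfold_gen fold_gen.
Qed.

End Fold.
End SphericalType.

Theorem theorem28 (I : Type) (Gamma : cmatrix I) (G : set (I -> I))
    (Gamma_coxeter : coxeter_matrix Gamma) (G_sub : subgroup_Aut Gamma G) :
  let Gamma' := folded_matrix Gamma G in
  let S' := folded_gens Gamma G in
  let S'g := artin_incl Gamma @` S' in
  [/\ coxeter_matrix Gamma',
      artin_mfixed Gamma G = gen_monoid S' /\
      pair_iso (artin_mfixed Gamma G) S'
        [set: artin_monoid Gamma'] (range (artin_mgen Gamma'))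
    & spherical Gamma [set: I] ->
      artin_gfixed Gamma G = gen_group S'g /\
      pair_iso (artin_gfixed Gamma G) S'g
        [set: artin_group Gamma'] (range (artin_gen Gamma'))].
Proof.
move=> Gamma' S' S'g; split; first exact: folded_coxeter.
  split; first exact: mfixed_gen_monoid.
  rewrite -range_fold // -[S']fold_image_gens //.
  by apply: pair_iso_inverse; [exact: foldM | exact: fold1 | exact: fold_inj].
move=> sph; split; first exact: gfixed_gen_group.
rewrite -range_gfold // -[S'g]gfold_image_gens //.
apply: pair_iso_inverse; [exact: gfoldM | | exact: gfold_inj].
by apply: ghom1; exact: gfoldM.
Qed.
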